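(* Let $\boldsymbol\lambda$ be a partition with at most $N$ parts, $n=|\boldsymbol\lambda|$, let $\tau_{\boldsymbol\lambda}:\mathcal O_{\boldsymbol\lambda}\to\mathcal B_{\boldsymbol\lambda}$ be the graded algebra isomorphism with $\tau_{\boldsymbol\lambda}(F_{ij})=\hat B_{ij}$, and let $v\in\mathcal M_{\boldsymbol\lambda}$ be a nonzero homogeneous vector of degree $\sum_{i=1}^N(i-1)\lambda_i$. Define $\mu_{\boldsymbol\lambda}:\mathcal O_{\boldsymbol\lambda}\to\mathcal M_{\boldsymbol\lambda}$, $F\mapsto\tau_{\boldsymbol\lambda}(F)v$. Then $\mu_{\boldsymbol\lambda}$ is an isomorphism of graded vector spaces of degree $\sum_{i=1}^N(i-1)\lambda_i$, and $\mu_{\boldsymbol\lambda}(FG)=\tau_{\boldsymbol\lambda}(F)\mu_{\boldsymbol\lambda}(G)$ for all $F,G\in\mathcal O_{\boldsymbol\lambda}$. In other words, $\tau_{\boldsymbol\lambda}$ and $\mu_{\boldsymbol\lambda}$ give an isomorphism of the regular representation of $\mathcal O_{\boldsymbol\lambda}$ with the $\mathcal B_{\boldsymbol\lambda}$-module $\mathcal M_{\boldsymbol\lambda}$.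
   Context: $\mathfrak{gl}_N$ has basis $e_{ij}$; singular vectors of weight $\boldsymbol\mu$: $e_{ii}v=\mu_iv$, $e_{ij}v=0$ ($i<j$). $V=\mathbb C^N$. $\mathfrak{gl}_N[t]=\mathfrak{gl}_N\otimes\mathbb C[t]$, $g(u)=\sum_{s\ge0}(g\otimes t^s)u^{-s-1}$; $\operatorname{rdet}A=\sum_\sigma\operatorname{sgn}(\sigma)a_{1\sigma(1)}a_{2\sigma(2)}\cdots$; $\operatorname{rdet}(\delta_{ij}\partial-e_{ji}(u))_{i,j=1}^N=\partial^N+\sum_iB_i(u)\partial^{N-i}$ with $\partial=d/du$ moved to the right, $B_i(u)=\sum_{j\ge1}B_{ij}u^{-j}$; the Bethe algebra $\mathcal B\subset U(\mathfrak{gl}_N[t])$ is generated by the $B_{ij}$. $\mathcal V=V^{\otimes n}\otimes\mathbb C[z_1,\dots,z_n]$ with $g(u)(p\,v_1\otimes\dots\otimes v_n)=p\sum_s\frac{v_1\otimes\dots\otimes gv_s\otimes\dots\otimes v_n}{u-z_s}$ and $S_n$ permuting factors and variables simultaneously; $\mathcal V$ is graded by $\deg z_i=1$; $\mathcal M_{\boldsymbol\lambda}=(\mathcal V^S)^{sing}_{\boldsymbol\lambda}$ (graded subspace of the $S_n$-invariants); $\mathcal B_{\boldsymbol\lambda}$ is the image of $\mathcal B$ in $\operatorname{End}(\mathcal M_{\boldsymbol\lambda})$ and $\hat B_{ij}$ the image of $B_{ij}$. $d_i=\lambda_i+N-i$, $P=\{d_i\}$, $\mathcal O_{\boldsymbol\lambda}=\mathbb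 C[f_{ij}:1\le j\le d_i,\,d_i-j\notin P]$ graded by $\deg f_{ij}=j$, $f_i(u)=u^{d_i}+\sum f_{ij}u^{d_i-j}$, $\operatorname{Wr}(g_1,\dots,g_N)=\det(g_i^{(j-1)})$, and $F_{ij}$ are defined by $\frac1{\operatorname{Wr}(f_1,\dots,f_N)}\operatorname{rdet}\begin{pmatrix}f_1&\dots&f_1^{(N)}\\ \vdots&&\vdots\\ f_N&\dots&f_N^{(N)}\\1&\dots&\partial^N\end{pmatrix}=\partial^N+\sum_iF_i(u)\partial^{N-i}$, $F_i(u)=\sum_{j\ge1}F_{ij}u^{-j}$. (The paper shows the homogeneous component of $\mathcal M_{\boldsymbol\lambda}$ of degree $\sum(i-1)\lambda_i$ is one-dimensional and is the lowest nonzero degree.) *)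

(* Defs.v *)
From HB Require Import structures.
From mathcomp Require Import all_boot all_algebra all_fingroup.
From mathcomp Require Import mpoly complex.
Set Implicit Arguments.
Unset Strict Implicit.
Unset Printing Implicit Defensive.
Import GRing.Theory.
Local Open Scope ring_scope.

(* Differential operators  sum_p a_p(u) d^p  (d = d/du written on the right)  *)
(* whose coefficients a_p are formal series  sum_k a_{p,k} w^k  with values in *)
(* a (possibly non-commutative) ring A.  The variable w is u (polynomials in *)
(* u) or u^{-1} (series in u^{-1}); the choice only affects the derivation    *)
(* [der] on coefficient series, which is a parameter.                         *)
(*   X : dop A,  X p k = coefficient of  w^k d^p.                             *)
(* [dmul bnd] is the product of normally ordered operators whose d-degree is  *)
(* < bnd (Leibniz rule  d^p b = sum_l C(p,l) b^(l) d^(p-l)), and [rdet] is    *)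
(* the row determinant  sum_s sgn(s) a_{1 s1} a_{2 s2} ... a_{K sK}.          *)
Section DiffOp.
Variables (A : pzRingType) (der : (nat -> A) -> nat -> A) (bnd : nat).

Definition smul (a b : nat -> A) : nat -> A :=
  fun k => \sum_(l < k.+1) a l * b (k - l)%N.

Definition dop := nat -> nat -> A.

Definition dmul (X Y : dop) : dop := fun r k =>
  \sum_(p < bnd) \sum_(q < bnd) \sum_(l < p.+1)
     (if (p + q - l == r)%N then 'C(p, l)%:R * smul (X p) (iter l der (Y q)) k
      else 0).

Definition dunit : dop := fun r k => ((r == 0%N) && (k == 0%N))%:R.

Definition rdet K (M : 'I_K -> 'I_K -> dop) : dop := fun r k =>
  \sum_(s : 'S_K) (-1) ^+ s * (\big[dmul/dunit]_(i < K) M i (s i)) r k.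

End DiffOp.

(* The space  V^{(x)n} (x) C[z_1..z_n],  V = C^N, as column vectors over     *)
(* P = C[z_1..z_n] indexed by the basis tensors v_{a_1}(x)...(x)v_{a_n},      *)
(* a : 'I_n -> 'I_N (encoded through enum_rank).                              *)
Section Gaudin.
Variables (Cf : fieldType) (N n : nat).

Definition Poly := {mpoly Cf[n]}.
Definition Tn := {ffun 'I_n -> 'I_N}.
Definition dimV := #|{: Tn}|.
Definition Mat := 'M[Poly]_dimV.
Definition Vec := 'cV[Poly]_dimV.

(* e_{ij} acting on the s-th tensor factor: e_{ij} v_k = delta_{jk} v_i *)
Definition Eop (s : 'I_n) (i j : 'I_N) : Mat :=
  \matrix_(a, b) ((((enum_val a : Tn) ==
                     [ffun t => if t == s then i else (enum_val b : Tn) t])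
                   && ((enum_val b : Tn) s == j))%:R).

Definition glact (i j : 'I_N) : Mat := \sum_(s < n) Eop s i j.

(* e_{ij}(u) = sum_s e_{ij}^{(s)} / (u - z_s) = sum_{k>=1} u^{-k} sum_s z_s^{k-1} e^{(s)}_{ij} *)
Definition eser (i j : 'I_N) : nat -> Mat :=
  fun k => if k is k'.+1 then \sum_(s < n) ('X_s ^+ k') *: Eop s i j else 0.

(* d/du on series in w = u^{-1}:  d/du w^k = - k w^{k+1} *)
Definition derW (a : nat -> Mat) : nat -> Mat :=
  fun k => if k is k'.+1 then - (a k' *+ k') else 0.

(* entries  delta_{ij} d - e_{ji}(u) *)
Definition BetheEntry (i j : 'I_N) : dop Mat := fun p k =>
  (if (i == j) && (p == 1%N) && (k == 0%N) then 1 else 0)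
  - (if p == 0%N then eser j i k else 0).

(* rdet(delta_{ij} d - e_{ji}(u)) = d^N + sum_i B_i(u) d^{N-i} *)
Definition BetheOp : dop Mat := rdet derW N.+1 BetheEntry.

Definition Bhat (i j : nat) : Mat := BetheOp (N - i)%N j.

Definition coord (x : Vec) (b : Tn) : Poly := x (enum_rank b) 0.

(* S_n-invariance:  sigma (p v_{a}) = p(z_{s 1},..,z_{s n}) v_{a o s^-1} *)
Definition Sn_invariant (x : Vec) : Prop :=
  forall (s : 'S_n) (b : Tn),
    coord x b = msym s (coord x [ffun t => b (s t)]).

Definition homogV (l : nat) (x : Vec) : Prop :=
  forall b : Tn, {in msupp (coord x b), forall mm, mdeg mm = l}.

Definition inM (lam : 'I_N -> nat) (x : Vec) : Prop :=
  [/\ Sn_invariant x,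
      forall i : 'I_N, glact i i *m x = (lam i)%:R *: x
    & forall i j : 'I_N, (i < j)%N -> glact i j *m x = 0].

Inductive bethe_gen : (Vec -> Vec) -> Prop :=
| bgB i j : (1 <= i <= N)%N -> (1 <= j)%N -> bethe_gen (fun x => Bhat i j *m x)
| bg1 : bethe_gen id
| bgD T U : bethe_gen T -> bethe_gen U -> bethe_gen (fun x => T x + U x)
| bgM T U : bethe_gen T -> bethe_gen U -> bethe_gen (fun x => T (U x))
| bgZ (c : Cf) T : bethe_gen T -> bethe_gen (fun x => c%:MP *: T x).

End Gaudin.

Section Olam.
Variables (Cf : fieldType) (N : nat) (lam : 'I_N -> nat).

(* d_i = lambda_i + N - i  (i 1-based; here r = i - 1) *)
Definition dd (r : 'I_N) : nat := (lam r + N - r.+1)%N.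
Definition Dmax : nat := \max_(r < N) dd r.

Definition idx_pred (p : 'I_N * 'I_Dmax.+1) : bool :=
  (1 <= p.2 <= dd p.1)%N && ~~ [exists r : 'I_N, dd r == (dd p.1 - p.2)%N].
Definition Idx := {p : 'I_N * 'I_Dmax.+1 | idx_pred p}.
Definition nvar : nat := #|{: Idx}|.
Definition Oring := {mpoly Cf[nvar]}.

Definition fvar (x : Idx) : Oring := 'X_(enum_rank x).

Definition wdeg (mm : 'X_{1..nvar}) : nat :=
  \sum_(v < nvar) (mm v * (val (enum_val v : Idx)).2)%N.
Definition whomog (k : nat) (F : Oring) : Prop :=
  {in msupp F, forall mm, wdeg mm = k}.

(* f_r(u) = u^{d_r} + sum_j f_{rj} u^{d_r - j}, as coefficient sequences in u
   (f_{rj} := 0 when d_r - j \in P) *)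
Definition fpoly (r : 'I_N) : nat -> Oring := fun k =>
  if k == dd r then 1
  else if (k < dd r)%N then
    oapp fvar 0 (insub (r, @inord Dmax (dd r - k)) : option Idx)
  else 0.

Definition derU (a : nat -> Oring) : nat -> Oring := fun k => a k.+1 *+ k.+1.

Definition dconst (c : nat -> Oring) : dop Oring :=
  fun p k => if p == 0%N then c k else 0.

Definition Wr : nat -> Oring :=
  fun k => rdet derU N.+1 (fun r c : 'I_N => dconst (iter c derU (fpoly r))) 0%N k.

(* the (N+1)x(N+1) matrix with rows (f_i, ..., f_i^{(N)}) and (1, d, ..., d^N) *)
Definition WrEntry (r c : 'I_N.+1) : dop Oring :=
  match unlift ord_max r with
  | Some r' => dconst (iter c derU (fpoly r'))
  | None => fun p k => ((p == c :> nat) && (k == 0%N))%:R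
  end.

Definition WrOp : dop Oring := rdet derU N.+1 WrEntry.

(* F_i(u) = sum_{j>=1} F_{ij} u^{-j} is the coefficient of d^{N-i} in
   (1/Wr) rdet(...), i.e. the Laurent series with Wr(u) F_i(u) = WrOp_{N-i}(u)
   (deg Wr <= sum_r d_r). *)
Definition is_F (F : nat -> nat -> Oring) : Prop :=
  forall i : nat, (1 <= i <= N)%N -> forall e : int,
    \sum_(k < (\sum_(r < N) dd r).+1)
       (if (1 <= k%:Z - e) then Wr k * F i (absz (k%:Z - e)) else 0)
    = (if 0 <= e then WrOp (N - i)%N (absz e) else 0).

End Olam.

(* Main.v *)
Require Import Defs.
From HB Require Import structures.
From mathcomp Require Import all_boot all_order all_algebra all_fingroup.
From mathcomp Require Import mpoly complex ring zify.
From Stdlib Require Import FunctionalExtensionality.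
(* Again, since [vector.coord] shadows [Defs.coord]. *)
Import Defs.
Set Implicit Arguments.
Unset Strict Implicit.
Unset Printing Implicit Defensive.
Import Order.TTheory GRing.Theory Num.Theory.
Local Open Scope ring_scope.

(* Injectivity: the coefficients of [B_1] act as power sums, hence every
   symmetric polynomial in the [z_s] is the action of some element of O_lambda.
   By Cayley-Hamilton every nonzero [G] in O_lambda divides a nonzero element
   acting as a symmetric polynomial, and multiplication by a nonzero polynomial
   does not kill [v].

   Surjectivity, by a dimension count in each degree.  Expanding in monomials,
   an element of M_lambda is a highest weight vector of the polynomial ring in
   variables [x_(i,k)], [k >= 0], with [e_ij = sum_k x_(i,k) d/dx_(j,k)].
   Splitting off the variables [x_(i,0)] and looking at an extremal coefficient,
   sl2-theory forces its weight to differ from lambda by a horizontal strip;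
   inductively, a highest weight vector is determined by its coefficients at
   semistandard tableaux of shape lambda, of degree the sum of the entries.
   The number of these tableaux obeys the same recursion as the coefficients of
   [q^(\sum (i-1) lambda_i) / \prod_hooks (1 - q^h)], the shifted Hilbert series
   of O_lambda: this is an identity between Vandermonde-type determinants. *)

(** * Weight arguments for sl2 acting on functions, with [D m] the vectors of weight m *)

Section Sl2.
Variables (C : numFieldType) (X : Type).
Implicit Types (x y : X -> C) (m : int).
Variables (E F : (X -> C) -> X -> C) (D : int -> (X -> C) -> Prop).
Hypothesis E_lin : forall a x y, E (fun w => a * x w + y w) = fun w => a * E x w + E y w.
Hypothesis F_lin : forall a x y, F (fun w => a * x w + y w) = fun w => a * F x w + F y w.
Hypothesis D_lin : forall m a x y, D m x -> D m y -> D m (fun w => a * x w + y w).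
Hypothesis D_E : forall m x, D m x -> D (m + 2) (E x).
Hypothesis D_F : forall m x, D m x -> D (m - 2) (F x).
Hypothesis comm_EF : forall m x, D m x -> forall w, E (F x) w = F (E x) w + m%:~R * x w.
Hypothesis F_nil : forall m x, D m x -> exists k, iter k F x = fun=> 0.

Let zeroE (f : (X -> C) -> X -> C) :
  (forall a x y, f (fun w => a * x w + y w) = fun w => a * f x w + f y w) ->
  f (fun=> 0) = fun=> 0.
Proof.
move=> fl; have := fl (-1) (fun=> 0) (fun=> 0).
have -> : (fun w : X => -1 * (0 : C) + 0) = fun=> 0.
  by apply: functional_extensionality => w; rewrite mulr0 addr0.
by move=> ->; apply: functional_extensionality => w; rewrite mulN1r addNr.
Qed.

Let scaleE (f : (X -> C) -> X -> C) a x :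
  (forall a x y, f (fun w => a * x w + y w) = fun w => a * f x w + f y w) ->
  f (fun w => a * x w) = fun w => a * f x w.
Proof.
move=> fl; have -> : (fun w => a * x w) = (fun w => a * x w + 0).
  by apply: functional_extensionality => w; rewrite addr0.
by rewrite fl zeroE //; apply: functional_extensionality => w; rewrite addr0.
Qed.

(** Each further lowering adds a nonpositive weight to the scalar, so E F^(k+1) x is a strictly
    negative multiple of F^k x for every k. The vanishing of F^k x for some k then descends to x. *)
Lemma lowering_chain_eq0 m (c : C) x : D m x -> m <= 0 -> c < 0 ->
  E (F x) = (fun w => c * x w) -> x = fun=> 0.
Proof.
move=> Dx m0 c0 EFx.
have chain k : D (m - k%:Z * 2) (iter k F x) /\
    exists2 c', c' < 0 & E (iter k.+1 F x) = fun w => c' * iter k F x w.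
  elim: k => [|k [Dk [c' c'0 Ek]]]; first by split; [rewrite mul0r subr0|exists c].
  have Dk1 : D (m - k.+1%:Z * 2) (iter k.+1 F x).
    have -> : m - k.+1%:Z * 2 = m - k%:Z * 2 - 2 by lia.
    exact: D_F.
  split=> //; exists (c' + (m - k.+1%:Z * 2)%:~R).
    rewrite -[0]addr0 ltr_leD // lerz0; lia.
  apply: functional_extensionality => w.
  by rewrite iterS (comm_EF Dk1) Ek scaleE // mulrDl.
have [k] := F_nil Dx.
elim: k => [//|k IH] k0; apply: IH.
have [_ [c' c'0]] := chain k; rewrite k0 zeroE // => Ek.
apply: functional_extensionality => w; apply/eqP.
have /eqP := congr1 (@^~ w) Ek; rewrite eq_sym mulf_eq0.
by rewrite (lt_eqF c'0).
Qed.

(** The integer is the sum of the weights m, m + 2, ..., m + 2q picked up while F moves past q + 1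
    copies of E. *)
Lemma iter_raise_lower q m x : D m x -> forall w,
  iter q.+1 E (F x) w =
  F (iter q.+1 E x) w + (q.+1%:Z * (m + q%:Z))%:~R * iter q E x w.
Proof.
move=> Dx; have Dk k : D (m + k%:Z * 2) (iter k E x).
  elim: k => [|k IH]; first by rewrite mul0r addr0.
  have -> : m + k.+1%:Z * 2 = m + k%:Z * 2 + 2 by lia.
  exact: D_E.
elim: q => [|q IH] w; first by rewrite /= (comm_EF Dx) addr0 mul1r.
have -> : iter q.+2 E (F x) = E (fun w =>
    (q.+1%:Z * (m + q%:Z))%:~R * iter q E x w + F (iter q.+1 E x) w).
  rewrite [iter q.+2 E _]iterS; congr E.
  by apply: functional_extensionality => z; rewrite IH addrC.
rewrite E_lin (comm_EF (Dk q.+1)) addrCA [iter q.+2 _ _]iterS; congr (_ + _).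
rewrite -mulrDl -rmorphD /=; congr (_%:~R * _); lia.
Qed.

(* For q = 1 this says that a highest weight vector has nonnegative weight;
   the inductive step shifts [F E] by its eigenvalue on the vectors of depth q. *)
Lemma raising_injective q m x : D m x -> m <= - q%:Z ->
  iter q E x = (fun=> 0) -> x = fun=> 0.
Proof.
elim: q m x => [//|q IH] m x Dx mq xq.
(* Since [E x] has weight m + 2, this is the coefficient produced by moving E^q past F in E^q F (E
   x). *)
pose c : int := q%:Z * (m + q%:Z + 1).
have Dx' : D m (fun w => - c%:~R * x w + F (E x) w).
  apply: D_lin => //; have -> : m = m + 2 - 2 by lia.
  by do 2!apply/D_F || apply/D_E.
have FE : F (E x) = fun w => c%:~R * x w.
  have /(IH _ _ Dx') Z : m <= - q%:Z by lia.
  suff /Z z0 : iter q E (fun w => - c%:~R * x w + F (E x) w) = fun=> 0.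
    apply: functional_extensionality => w.
    have /eqP := congr1 (@^~ w) z0.
    by rewrite addrC mulNr subr_eq0 => /eqP.
  have lin k : iter k E (fun w => - c%:~R * x w + F (E x) w) =
      fun w => - c%:~R * iter k E x w + iter k E (F (E x)) w.
    by elim: k => // k IHk; rewrite !iterS IHk E_lin.
  rewrite lin; apply: functional_extensionality => w.
  case: q @c {IH Dx' Z lin} mq xq => [|q] c mq xq.
    have Fx0 : F (E x) w = 0 by move: xq => /= ->; rewrite zeroE.
    by rewrite /= Fx0 addr0 /c mul0r mulr0z oppr0 mul0r.
  rewrite (iter_raise_lower q (D_E Dx)) -!iterSr xq zeroE // add0r mulNr.
  by apply/eqP; rewrite addrC subr_eq0; apply/eqP; congr (_%:~R * _); rewrite /c; lia.
apply: (@lowering_chain_eq0 m ((c + m)%:~R) x Dx); first by lia.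
  by rewrite ltrz0 /c; nia.
apply: functional_extensionality => w.
by rewrite (comm_EF Dx) FE -mulrDl -rmorphD.
Qed.

End Sl2.

(** * Highest weight vectors in a polynomial ring, and semistandard tableaux *)

Section Columns.
Variables (C : numFieldType) (N : nat).
Local Notation col := {ffun 'I_N -> nat}.
Implicit Types (a b : col) (w : seq col) (c g : seq col -> C) (i j r : 'I_N).

(** The truncated subtraction at [a i = 0] does no harm: [raise] gives that term the factor
    [a i]. *)
Definition transfer i j a : col := [ffun r => a r - (r == i) + (r == j)]%N.

(* A list [w] of columns encodes the divided power monomial in the [x_(i,k)] with
   exponents [nth _ w k i]; [raise i j] is [sum_k x_(i,k) d/dx_(j,k)] acting on
   coefficient functions. *)
Fixpoint raise i j c w : C :=
  if w is a :: w' then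
    (a i)%:R * c (transfer i j a :: w') + raise i j (fun v => c (a :: v)) w'
  else 0.

Definition colwt w i := (\sum_(a <- w) a i)%N.
Definition colsum a := (\sum_i a i)%N.
(** Adding the totals of all proper tails counts the column of index k exactly k times, so this is
    the sum of the entries of a tableau. *)
Fixpoint coldeg w := if w is a :: w' then (coldeg w' + \sum_(b <- w') colsum b)%N else 0%N.

Lemma colwt_cons a w i : colwt (a :: w) i = (a i + colwt w i)%N.
Proof. by rewrite /colwt big_cons. Qed.

Lemma raise_lin i j (x : C) c g :
  raise i j (fun w => x * c w + g w) = fun w => x * raise i j c w + raise i j g w.
Proof.
apply: functional_extensionality => w.
elim: w c g => [|a w IH] c g /=; first by rewrite mulr0 addr0.
by rewrite IH; ring.
Qed.

Lemma raise0 i j w : raise i j (fun=> 0) w = 0.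
Proof. by elim: w => //= a w ->; rewrite mulr0 addr0. Qed.

Lemma raise_scale i j (x : C) c w : raise i j (fun v => x * c v) w = x * raise i j c w.
Proof.
have -> : (fun v => x * c v) = fun v => x * c v + 0.
  by apply: functional_extensionality => v; rewrite addr0.
by rewrite raise_lin raise0 addr0.
Qed.

Lemma raise_neq0 i j c w : i != j -> raise i j c w != 0 ->
  exists2 v, c v != 0 &
    size v = size w /\ (forall r, colwt v r + (r == i) = colwt w r + (r == j))%N.
Proof.
move=> ij; elim: w c => [|a w IH] c /=; first by rewrite eqxx.
have [-> | rest0 _] := eqVneq (raise i j (fun v => c (a :: v)) w) 0.
  rewrite addr0 mulf_eq0 negb_or pnatr_eq0 => /andP[ai cv].
  exists (transfer i j a :: w) => //; split=> // r.
  rewrite !colwt_cons ffunE.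
  have : ((r == i) <= a r)%N by case: eqP => [->|]; rewrite ?lt0n.
  by case: (r == i); case: (r == j) => /=; lia.
have [v cv [sv wv]] := IH _ rest0; exists (a :: v) => //; split; first by rewrite /= sv.
by move=> r; rewrite !colwt_cons -!addnA wv.
Qed.

Lemma transferK i j a : i != j -> (0 < a i)%N -> transfer j i (transfer i j a) = a.
Proof.
move=> ij ai; apply/ffunP => r; rewrite !ffunE.
have := ij; case: (eqVneq r i) => [->|_]; case: (eqVneq _ j) => //=; lia.
Qed.

(** Terms acting on two different columns commute; within one column the commutator is a_i (a_j + 1)
    - a_j (a_i + 1) = a_i - a_j. *)
Lemma raise_comm i j c w : i != j ->
  raise i j (raise j i c) w =
  raise j i (raise i j c) w + ((colwt w i)%:Z - (colwt w j)%:Z)%:~R * c w.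
Proof.
move=> ij; have ji : j != i by rewrite eq_sym.
elim: w c => [|a w IH] c /=; first by rewrite /colwt !big_nil subrr mul0r addr0.
have raise_head i' j' (b : col) (d : seq col -> C) :
    raise i' j' (fun v => (b j')%:R * c (transfer j' i' b :: v) + d v) w =
    (b j')%:R * raise i' j' (fun v => c (transfer j' i' b :: v)) w + raise i' j' d w.
  by rewrite raise_lin.
rewrite !raise_head IH !colwt_cons.
have mvv i' j' : i' != j' -> (a i')%:R * (transfer i' j' a j')%:R *
    c (transfer j' i' (transfer i' j' a) :: w)
    = (a i')%:R * (a j').+1%:R * c (a :: w).
  move=> ij'; have [->|ai] := posnP (a i'); first by rewrite !mul0r.
  by rewrite transferK // ffunE eqxx eq_sym (negPf ij') subn0 addn1.
have -> : ((a i + colwt w i)%N%:Z - (a j + colwt w j)%N%:Z)%:~R =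
    (a i)%:R - (a j)%:R + ((colwt w i)%:Z - (colwt w j)%:Z)%:~R :> C.
  rewrite !PoszD !rmorphB !rmorphD /= -!pmulrn; ring.
have := mvv i j ij; have := mvv j i ji; rewrite -!natr1.
set s1 := _ * c _; set s2 := _ * c (transfer j i (transfer i j a) :: w).
rewrite !mulrDr !mulrA -/s1 -/s2 => -> ->; ring.
Qed.

(** Besides the sl2-weight m, the total s of the two rows is recorded: it bounds the weight below by
    -s, which makes lowering nilpotent. *)
Definition sl2wt i j (s m : int) c := forall w, c w != 0 ->
  (colwt w i)%:Z - (colwt w j)%:Z = m /\ (colwt w i)%:Z + (colwt w j)%:Z = s.

Lemma sl2wt_raise i j s m c : i != j -> sl2wt i j s m c ->
  sl2wt i j s (m + 2) (raise i j c) /\ sl2wt i j s (m - 2) (raise j i c).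
Proof.
move=> ij cm; have ji : j != i by rewrite eq_sym.
split=> w /raise_neq0.
- case/(_ ij) => v /cm vm [_ wt]; have := wt i; have := wt j.
  rewrite !eqxx (negPf ij) (negPf ji); lia.
- case/(_ ji) => v /cm vm [_ wt]; have := wt i; have := wt j.
  rewrite !eqxx (negPf ij) (negPf ji); lia.
Qed.

Lemma raise_injective i j s m q c : i != j -> sl2wt i j s m c ->
  m <= - q%:Z -> iter q (raise i j) c = (fun=> 0) -> c = fun=> 0.
Proof.
move=> ij; apply: (@raising_injective C (seq col) _ (raise j i)) => //.
- by move=> *; exact: raise_lin.
- by move=> *; exact: raise_lin.
- move=> {}m x g h gm hm w; have [g0|/gm //] := eqVneq (g w) 0.
  by rewrite g0 mulr0 add0r => /hm.
- by move=> {}m g /(sl2wt_raise ij)[].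
- by move=> {}m g /(sl2wt_raise ij)[].
- move=> {}m g gm w; rewrite raise_comm //.
  by have [->|/gm[-> _]//] := eqVneq (g w) 0; rewrite !mulr0.
- move=> {}m g gm; exists (absz (m + s)).+1.
  have gk k : sl2wt i j s (m - k%:Z * 2) (iter k (raise j i) g).
    elim: k => [|k IH]; first by rewrite mul0r subr0.
    have -> : m - k.+1%:Z * 2 = m - k%:Z * 2 - 2 by lia.
    by have [_] := sl2wt_raise ij IH.
  apply: functional_extensionality => w; apply: contraTeq isT => /gk; lia.
Qed.

Definition hstrip (lam nu : col) :=
  [forall i, nu i <= lam i]%N && [forall i : 'I_N, forall j : 'I_N, (i < j) ==> (lam j <= nu i)]%N.

(* The coefficient [c (a :: _)] is a highest weight vector lying in the image of
   [iter (a j) (raise i j)]; in a finite-dimensional sl2-module this bounds its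
   weight below by [a j]. *)
Lemma leading_strip i j (lam a : col) c : (i < j)%N ->
  (forall w, c w != 0 -> forall r, colwt w r = lam r) ->
  (forall w, raise i j c w = 0) ->
  (forall w, raise i j (fun v => c (a :: v)) w = 0) ->
  (lam i < lam j + a i)%N -> forall w, c (a :: w) = 0.
Proof.
move=> lt_ij cwt Ec Ea lt_lam.
have ij : i != j by rewrite neq_ltn lt_ij.
(* Move t units of the first column from row j to row i. The equation [Ec] at the column [up t.+1]
   expresses [g t] through [raise i j (g t.+1)], so [g 0] is reached from [g (a j)]. *)
pose up t : col := [ffun r => a r + t * (r == i) - t * (r == j)]%N.
have up0 : up 0%N = a by apply/ffunP => r; rewrite ffunE !mul0n addn0 subn0.
pose g t := fun w => c (up t :: w).
have g0 : g 0%N = fun w => c (a :: w) by rewrite /g up0.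
have step t : (t < a j)%N -> raise i j (g t.+1) = fun w => - (a i + t.+1)%:R * g t w.
  move=> lt_t; apply: functional_extensionality => w.
  have := Ec (up t.+1 :: w); rewrite /= -/(g t.+1) addrC => /eqP; rewrite addr_eq0 => /eqP ->.
  rewrite mulNr ffunE eqxx (negPf ij) muln0 subn0 muln1; congr (- (_ * c (_ :: w))).
  apply/ffunP => r; rewrite !ffunE.
  by have := ij; case: (eqVneq r i) => [-> /negPf->|_ _] /=; [lia | case: (eqVneq r j) => [->|_]; lia].
have iterg s : (s <= a j)%N -> exists2 x : C, x != 0 &
    iter s (raise i j) (g (a j)) = fun w => x * g (a j - s)%N w.
  elim: s => [_|s IH lt_s].
    exists 1; rewrite ?oner_eq0 //.
    by apply: functional_extensionality => w; rewrite mul1r subn0.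
  have [x x0 Es] := IH (ltnW lt_s).
  exists (x * - (a i + (a j - s.+1).+1)%:R).
    by rewrite mulf_neq0 // oppr_eq0 pnatr_eq0 addnS.
  rewrite iterS Es; apply: functional_extensionality => w.
  rewrite raise_scale -subnSK // step ?mulrA //; lia.
have [x x0] := iterg (a j) (leqnn _); rewrite subnn g0 => Ep.
have Ep1 : iter (a j).+1 (raise i j) (g (a j)) = fun=> 0.
  rewrite iterS Ep; apply: functional_extensionality => w.
  by rewrite raise_scale Ea mulr0.
(* The column [up (a j)] has a_i + a_j in row i and nothing in row j; s and m are the sum and
   difference of the weights left for the tail. *)
pose s : int := (lam i)%:Z + (lam j)%:Z - (a i + a j)%N%:Z.
pose m : int := (lam i)%:Z - (lam j)%:Z - (a i + a j)%N%:Z.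
have gm : sl2wt i j s m (g (a j)).
  move=> w /cwt wt; have := wt i; have := wt j.
  rewrite !colwt_cons !ffunE !eqxx (negPf ij) eq_sym (negPf ij) /s /m; lia.
have /(raise_injective ij gm) /(_ Ep1) gp0 : m <= - (a j).+1%:Z by rewrite /m; lia.
move=> w; have := congr1 (@^~ w) Ep; rewrite gp0.
have -> : iter (a j) (raise i j) (fun=> 0) w = 0.
  elim: (a j) w => //= k IH w.
  by rewrite (_ : iter k _ _ = fun=> 0) ?raise0 //; apply: functional_extensionality.
by move=> /esym /eqP; rewrite mulf_eq0 (negPf x0) => /eqP.
Qed.

Definition hstrips (lam : col) : seq col :=
  [seq nu : col <- [seq [ffun i => val (f i)] | f : {ffun 'I_N -> 'I_(colsum lam).+1}]
     | hstrip lam nu].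

(* Semistandard tableaux of shape [lam] with entries below [K] and sum [k]; column
   [l] of the list records how many entries of each row are equal to [l]. *)
Fixpoint ssyt K (lam : col) (k : nat) : seq (seq col) :=
  if K is K'.+1 then
    flatten [seq [seq [ffun i => (lam i - nu i)%N] :: w | w <- ssyt K' nu (k - colsum nu)]
              | nu : col <- hstrips lam & (colsum nu <= k)%N]
  else if (colsum lam == 0%N) && (k == 0%N) then [:: [::]] else [::].

Lemma mem_hstrips lam nu : (nu \in hstrips lam) = hstrip lam nu.
Proof.
rewrite mem_filter andb_idr // => /andP[/forallP le_nu _].
apply/mapP; exists [ffun i => inord (nu i)]; rewrite ?mem_enum //.
apply/ffunP => i; rewrite !ffunE /= inordK // ltnS.
by apply: leq_trans (le_nu i) _; rewrite /colsum (bigD1 i) //= leq_addr.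
Qed.

Lemma colsum_colwt w : (\sum_(b <- w) colsum b = \sum_i colwt w i)%N.
Proof. by rewrite exchange_big. Qed.

(* A highest weight vector is determined by its coefficients at semistandard
   tableaux: consider its nonzero coefficient [c (a :: _)] with
   [\sum_i i * a i] maximal, which is again a highest weight vector. *)
Lemma ssyt_determine K (lam : col) k c :
  (forall w, c w != 0 ->
     [/\ size w = K, (forall r, colwt w r = lam r) & coldeg w = k]) ->
  (forall i j, (i < j)%N -> forall w, raise i j c w = 0) ->
  (forall w, w \in ssyt K lam k -> c w = 0) -> forall w, c w = 0.
Proof.
elim: K lam k c => [|K IH] lam k c supp Ec cS w.
  apply: contraTeq isT => cw; have [/size0nil w0 wt dg] := supp w cw.
  move: cw; rewrite cS ?eqxx // w0 /= -dg w0 /= eqxx andbT.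
  rewrite (_ : colsum lam = 0%N) // /colsum big1 // => i _.
  by rewrite -wt w0 /colwt big_nil.
case: w => [|a w]; first by apply: contraTeq isT => /supp[].
(* On the support this statistic is at most [B], so induction on [B - Phi a] treats columns with
   larger [Phi] first. *)
pose Phi (b : col) := (\sum_(i < N) i * b i)%N.
pose B := (N * colsum lam)%N.
have PhiB b v : c (b :: v) != 0 -> (Phi b <= B)%N.
  move=> /supp[_ wt _]; rewrite /Phi /B /colsum big_distrr leq_sum // => i _.
  rewrite leq_mul // ?(ltnW (ltn_ord i)) //.
  by rewrite -wt colwt_cons leq_addr.
have [m] := ubnP (B - Phi a)%N; elim: m a w => // m IHm a w.
rewrite ltnS => leBm.
have higher b v : (Phi a < Phi b)%N -> c (b :: v) = 0.
  move=> lt_ab; apply: contraTeq isT => cb.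
  by move: (cb); rewrite IHm ?eqxx //; have := PhiB _ _ cb; lia.
(* For i < j the first term of [raise] at [a :: v] has leading column [transfer i j a], whose [Phi]
   is larger, so it vanishes by [higher]. *)
have Ea i j : (i < j)%N -> forall v, raise i j (fun u => c (a :: u)) v = 0.
  move=> lt_ij v; have := Ec i j lt_ij (a :: v); rewrite /=.
  have [->|ai] := posnP (a i); first by rewrite mul0r add0r.
  rewrite higher ?mulr0 ?add0r //.
  have ij : i != j by rewrite neq_ltn lt_ij.
  rewrite /Phi (bigD1 i) // (bigD1 j) 1?eq_sym //=.
  rewrite [ltnRHS](bigD1 i) // [in ltnRHS](bigD1 j) 1?eq_sym //=.
  rewrite !ffunE !eqxx (negPf ij) eq_sym (negPf ij).
  rewrite [X in (_ < _ + (_ + X))%N](eq_bigr (fun r : 'I_N => r * a r)%N).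
    by case: (a i) ai => // ai' _; rewrite !addnA ltn_add2r; nia.
  by move=> r /andP[ri rj]; rewrite ffunE (negPf ri) (negPf rj) subn0 addn0.
apply: contraTeq isT => caw.
have [size_w wt_w deg_w] := supp _ caw.
have le_a i : (a i <= lam i)%N by rewrite -wt_w colwt_cons leq_addr.
pose nu : col := [ffun i => lam i - a i]%N.
have nu_strip : hstrip lam nu.
  apply/andP; split; first by apply/forallP => i; rewrite ffunE leq_subr.
  apply/forallP => i; apply/forallP => j; apply/implyP => lt_ij.
  rewrite ffunE leqNgt; apply/negP => lt_lam.
  have lam_a : (lam i < lam j + a i)%N by have := le_a i; lia.
  have cwt v : c v != 0 -> forall r, colwt v r = lam r by case/supp.
  move/eqP: caw; apply.
  exact: (leading_strip lt_ij cwt (Ec _ _ lt_ij) (Ea _ _ lt_ij) lam_a).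
have tot_w : colsum nu = (\sum_(b <- w) colsum b)%N.
  rewrite colsum_colwt; apply: eq_bigr => i _.
  by rewrite ffunE -wt_w colwt_cons addKn.
have le_k : (colsum nu <= k)%N by rewrite -deg_w tot_w /= leq_addl.
move: caw; rewrite (IH nu (k - colsum nu)%N (fun v => c (a :: v))) ?eqxx //.
- move=> v /supp[[size_v] wt_v deg_v]; split=> //.
    by move=> r; rewrite ffunE -wt_v colwt_cons addKn.
  have -> : colsum nu = (\sum_(b <- v) colsum b)%N.
    rewrite colsum_colwt; apply: eq_bigr => i _.
    by rewrite ffunE -wt_v colwt_cons addKn.
  by rewrite -deg_v /= addnK.
- move=> v vS; apply: cS; apply/flattenP.
  exists [seq [ffun i => (lam i - nu i)%N] :: u | u <- ssyt K nu (k - colsum nu)].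
    by apply/mapP; exists nu; rewrite // mem_filter le_k mem_hstrips.
  apply/mapP; exists v => //; congr (_ :: v).
  by apply/ffunP => i; rewrite !ffunE subKn.
Qed.

End Columns.

(** * Vandermonde-type determinants and the hook product recursion *)

Section HookDet.
Variables (K : fieldType) (q : K).
Hypothesis q_neq0 : q != 0.
Hypothesis q_generic : forall m, 1 - q ^+ m.+1 != 0.

(** The q-Pochhammer symbol (q; q)_d. *)
Definition qfact d := \prod_(m < d) (1 - q ^+ m.+1).
(** Vandermonde entries in q^d, normalised by row. The summands of [qsum j] are q^e [qpow j e], as
    they arise from interlacing. *)
Definition qpow j d := q ^+ (d * j) / qfact d.
Definition qsum j d := \sum_(e < d.+1) q ^+ (e * j.+1) / qfact e.

Lemma qfact_neq0 d : qfact d != 0.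
Proof. by apply/prodf_neq0 => m _. Qed.

Lemma qsumS j d : qsum j d.+1 = qsum j d + q ^+ (d.+1 * j.+1) / qfact d.+1.
Proof. by rewrite /qsum big_ord_recr. Qed.

(* Both sides telescope in [d]. *)
Lemma qpow_qsum j d : q ^+ j.+1 * qpow j.+1 d = (q ^+ j.+1 - 1) * qsum j d + qsum j.+1 d.
Proof.
elim: d => [|d IH].
  by rewrite /qpow /qsum !big_ord1 !mul0n !expr0 /qfact big_ord0 invr1; ring.
rewrite !qsumS mulrDr addrACA -IH /qpow.
have -> : qfact d.+1 = qfact d * (1 - q ^+ d.+1) by rewrite /qfact big_ord_recr.
have -> : (d.+1 * j.+1 = d * j.+1 + j.+1)%N by rewrite mulSn addnC.
have -> : (d.+1 * j.+2 = d * j.+1 + j.+1 + d.+1)%N by rewrite !mulSn !mulnS; lia.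
rewrite !exprD; have := qfact_neq0 d; have := q_generic d.
by move: (q ^+ d.+1) (qfact d) => x y x1 y0; field; rewrite x1.
Qed.

Lemma qpow0 d : qpow 0 d = qsum 0 d.
Proof.
elim: d => [|d IH].
  by rewrite /qpow /qsum big_ord1.
rewrite qsumS -IH /qpow.
have -> : qfact d.+1 = qfact d * (1 - q ^+ d.+1) by rewrite /qfact big_ord_recr.
rewrite !muln0 muln1 expr0; have := qfact_neq0 d; have := q_generic d.
by move: (q ^+ d.+1) (qfact d) => x y x1 y0; field; rewrite x1.
Qed.

Variable N : nat.
Implicit Type d : 'I_N -> nat.

Definition qdet d := \det (\matrix_(i < N, j < N) qpow j (d i)).

(** By [qpow_qsum], column j of the [qpow] matrix times q^j is column j of the [qsum] matrix plus a
    multiple of column j - 1: a unitriangular change of columns. *)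
Lemma det_qsum d :
  \det (\matrix_(i < N, j < N) qsum j (d i)) = q ^+ (\sum_(j < N) j) * qdet d.
Proof.
pose U : 'M[K]_N := \matrix_(i, j) ((i == j)%:R + (i.+1 == j)%:R * (q ^+ j - 1)).
have detU : \det U = 1.
  rewrite -det_tr det_trig.
    by apply: big1 => i _; rewrite !mxE eqxx (gtn_eqF (ltnSn i)) mul0r addr0.
  apply/is_trig_mxP => i j lt_ij; rewrite !mxE.
  by rewrite (gtn_eqF (leqW lt_ij)) -val_eqE /= (gtn_eqF lt_ij) mul0r addr0.
pose Dg : 'rV[K]_N := \row_j q ^+ j.
have E : (\matrix_(i < N, j < N) qpow j (d i)) *m diag_mx Dg =
    (\matrix_(i < N, j < N) qsum j (d i)) *m U.
  apply/matrixP => i j; rewrite mul_mx_diag !mxE.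
  under eq_bigr do rewrite !mxE mulrDr.
  rewrite big_split /= (bigD1 j) //= eqxx mulr1 [X in _ + X + _]big1 ?addr0; last first.
    by move=> k /negPf kj; rewrite kj mulr0.
  case: j => -[|j] lt_j /=.
    by rewrite expr0 mulr1 qpow0 big1 ?addr0 // => k _; rewrite mul0r mulr0.
  rewrite mulrC qpow_qsum addrC; congr (_ + _).
  rewrite (bigD1 (Ordinal (ltnW lt_j))) //= eqxx mul1r mulrC big1 ?addr0 // => k.
  by rewrite -val_eqE /= eqSS => /negPf->; rewrite mul0r mulr0.
have := congr1 determinant E; rewrite !det_mulmx detU mulr1 det_diag => <-.
rewrite mulrC /qdet; congr (_ * _); rewrite -prodrXr.
by apply: eq_bigr => j _; rewrite mxE.
Qed.

Lemma qdet_vandermonde d :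
  qdet d = \prod_(i < N) \prod_(j < N | (i < j)%N) (q ^+ d j - q ^+ d i) / \prod_i qfact (d i).
Proof.
pose a : 'rV[K]_N := \row_i q ^+ d i.
have -> : qdet d = \det (diag_mx (\row_i (qfact (d i))^-1) *m (Vandermonde N a)^T).
  congr (\det _); apply/matrixP => i j.
  by rewrite mul_diag_mx !mxE /qpow exprM mulrC.
rewrite det_mulmx det_diag det_tr det_Vandermonde mulrC; congr (_ * _).
  by apply: eq_bigr => i _; apply: eq_bigr => j _; rewrite !mxE.
by rewrite -prodfV; apply: eq_bigr => i _; rewrite mxE.
Qed.

(** For a partition, the j allowed here are the hook lengths in row r; they are also the degrees of
    the generators f_(r,j). *)
Definition hook_prod (lam : 'I_N -> nat) :=
  \prod_(r < N) \prod_(1 <= j < (dd lam r).+1 |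
     ~~ [exists r', dd lam r' == (dd lam r - j)%N]) (1 - q ^+ j).

(** The statistic usually written n(lambda), which is the degree of [v]. *)
Definition content (lam : 'I_N -> nat) := (\sum_(i < N) i * lam i)%N.

Definition is_part (lam : 'I_N -> nat) :=
  forall i j : 'I_N, (i <= j)%N -> (lam j <= lam i)%N.

Lemma dd_decr lam (i j : 'I_N) : is_part lam -> (i < j)%N -> (dd lam j < dd lam i)%N.
Proof.
move=> lamP lt_ij; rewrite /dd; have := lamP i j (ltnW lt_ij).
by have := ltn_ord i; have := ltn_ord j; lia.
Qed.

(** The numbers 1, ..., d_r split into the hook lengths of row r and the differences d_r - d_s with
    s > r, which are distinct as d strictly decreases. *)
Lemma prod_qfact_hooks lam : is_part lam ->
  \prod_(i < N) qfact (dd lam i) =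
  hook_prod lam * \prod_(i < N) \prod_(j < N | (i < j)%N) (1 - q ^+ (dd lam i - dd lam j)).
Proof.
move=> lamP; rewrite /hook_prod -big_split; apply: eq_bigr => r _ /=.
set d := dd lam.
have -> : qfact (d r) = \prod_(1 <= j < (d r).+1) (1 - q ^+ j).
  by rewrite big_add1 big_mkord.
rewrite (bigID (fun j => ~~ [exists r', d r' == (d r - j)%N])) /=; congr (_ * _).
under eq_bigl do rewrite negbK.
transitivity (\prod_(s < N | (r < s)%N)
    \prod_(1 <= j < (d r).+1 | j == (d r - d s)%N) (1 - q ^+ j)); last first.
  apply: eq_bigr => s lt_rs; rewrite big_nat1_eq ltnS leq_subr andbT subn_gt0.
  by rewrite dd_decr.
rewrite (exchange_big_dep (fun j => [exists r', d r' == (d r - j)%N])) /=; last first.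
  move=> s j lt_rs /eqP->; apply/existsP; exists s.
  by rewrite subKn // ltnW // dd_decr.
rewrite big_nat_cond [RHS]big_nat_cond; apply: eq_bigr => j.
case/andP=> /andP[j1 le_j] /existsP[r0 /eqP d0].
have lt_r0 : (r < r0)%N.
  rewrite ltnNge leq_eqVlt; apply/norP; split; last first.
    apply/negP => /(dd_decr lamP); rewrite -/d d0; lia.
  by apply/negP => /eqP/val_inj E; move: d0; rewrite E; lia.
rewrite (big_pred1 r0) // => s; apply/andP/eqP => [[lt_rs /eqP Ej]|->].
  have lt_d := dd_decr lamP lt_rs; rewrite -/d in lt_d.
  have [lt_s|lt_s|/val_inj//] := ltngtP s r0; have := dd_decr lamP lt_s; rewrite -/d; lia.
by split=> //; apply/eqP; lia.
Qed.

Lemma hook_prod_neq0 lam : hook_prod lam != 0.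
Proof.
apply/prodf_neq0 => r _; rewrite big_nat_cond.
apply: (big_ind (fun x : K => x != 0)); rewrite ?oner_eq0 //; first exact: mulf_neq0.
by case=> [|m] //= _; exact: q_generic.
Qed.

Lemma sum_below (f : 'I_N -> nat) :
  (\sum_(i < N) \sum_(j < N | (i < j)%N) f j = \sum_(j < N) j * f j)%N.
Proof.
rewrite (exchange_big_dep predT) //=; apply: eq_bigr => j _.
rewrite sum_nat_const; congr (_ * _)%N.
rewrite -sum1_card -(big_ord_widen N (fun=> 1%N)) ?sum1_card ?card_ord //.
exact: ltnW.
Qed.

(** Taking q^(d_j) out of each Vandermonde factor leaves exactly the difference factors of
    [prod_qfact_hooks], which cancel. *)
Lemma qdet_hooks lam : is_part lam ->
  qdet (dd lam) = q ^+ (\sum_(j < N) j * dd lam j) / hook_prod lam.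
Proof.
move=> lamP; rewrite qdet_vandermonde prod_qfact_hooks //.
have -> : \prod_(i < N) \prod_(j < N | (i < j)%N) (q ^+ dd lam j - q ^+ dd lam i) =
    q ^+ (\sum_(j < N) j * dd lam j) *
    \prod_(i < N) \prod_(j < N | (i < j)%N) (1 - q ^+ (dd lam i - dd lam j)).
  rewrite -sum_below -prodrXr -big_split; apply: eq_bigr => i _ /=.
  rewrite -prodrXr -big_split; apply: eq_bigr => j lt_ij /=.
  by rewrite mulrBr mulr1 -exprD subnKC // ltnW // dd_decr.
rewrite -mulf_div divff ?mulr1 //; apply/prodf_neq0 => i _; apply/prodf_neq0 => j lt_ij.
by have := dd_decr lamP lt_ij; rewrite -subn_gt0; case: (_ - _)%N.
Qed.

(* By multilinearity the sum over the interlacing [nu] is a determinant whose rows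
   are differences of consecutive rows of the matrix of [det_qsum]. *)
Lemma qdet_interlace lam : is_part lam ->
  \sum_(nu <- hstrips [ffun i => lam i]) q ^+ (\sum_i dd nu i) * qdet (dd nu) =
  q ^+ (\sum_(j < N) j) * qdet (dd lam).
Proof.
move=> lamP; rewrite -det_qsum.
pose h j e := q ^+ e * qpow j e.
pose T j D := \sum_(0 <= e < D) h j e.
have qsumE j (d : nat) : qsum j d = T j d.+1.
  rewrite /T big_mkord; apply: eq_bigr => e _.
  by rewrite /h /qpow mulrA -exprD mulnS.
(* The next row length, read as 0 below the last row; an interlacing [nu i] runs from [lo i] to
   [lam i]. *)
pose lo (i : 'I_N) := oapp lam 0%N (insub i.+1 : option 'I_N).
pose L : 'M[K]_N := \matrix_(i, j) ((i == j)%:R - (i.+1 == j)%:R).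
have detL : \det L = 1.
  rewrite -det_tr det_trig.
    by apply: big1 => i _; rewrite !mxE eqxx (gtn_eqF (ltnSn i)) subr0.
  apply/is_trig_mxP => i j lt_ij; rewrite !mxE.
  by rewrite (gtn_eqF (leqW lt_ij)) -val_eqE /= (gtn_eqF lt_ij) subr0.
set Phi := \matrix_(i < N, j < N) _.
have -> : \det Phi = \det (L *m Phi) by rewrite det_mulmx detL mul1r.
pose B := colsum [ffun i => lam i].
have le_B i : (lam i <= B)%N.
  by rewrite /B /colsum (bigD1 i) //= ffunE leq_addr.
have le_lo i : (lo i <= lam i)%N.
  rewrite /lo; case: insubP => //= i' _ Ei; apply: lamP; rewrite Ei; exact: leqnSn.
pose dom (i : 'I_N) (m : 'I_B.+1) := (lo i <= m <= lam i)%N.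
pose G (i j : 'I_N) (m : 'I_B.+1) := h j (m + (N - i.+1))%N.
have LPhi i j : (L *m Phi) i j = \sum_(m | dom i m) G i j m.
  rewrite mxE.
  have -> : \sum_k L i k * Phi k j = qsum j (dd lam i) -
      oapp (fun i' : 'I_N => qsum j (dd lam i')) 0 (insub i.+1 : option 'I_N).
    under eq_bigr do rewrite !mxE mulrBl.
    rewrite sumrB; congr (_ - _).
      rewrite (bigD1 i) //= eqxx mul1r big1 ?addr0 // => k /negPf.
      by rewrite eq_sym => ->; rewrite mul0r.
    case: insubP => [i' lt_i Ei|lt_i] /=.
      rewrite (bigD1 i') //= Ei eqxx mul1r big1 ?addr0 // => k.
      by rewrite -val_eqE /= Ei eq_sym => /negPf->; rewrite mul0r.
    rewrite big1 // => k _; case: eqP => [Ek|]; rewrite ?mul0r //.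
    by move: lt_i; rewrite Ek ltn_ord.
  (* The upper limit d_(i+1) + 1 of the subtracted sum is lo_i + (N - i - 1); in the last row it is
     0 and the sum is empty. *)
  have -> : oapp (fun i' : 'I_N => qsum j (dd lam i')) 0 (insub i.+1 : option 'I_N)
      = T j (lo i + (N - i.+1))%N.
    rewrite /lo; case: insubP => [i' lt_i Ei|lt_i] /=.
      by rewrite qsumE; congr T; rewrite /dd Ei; have := ltn_ord i'; rewrite Ei; lia.
    rewrite /T add0n (_ : (N - i.+1 = 0)%N) ?big_geq //.
    by have := ltn_ord i; lia.
  rewrite qsumE /T (@big_cat_nat _ _ _ (lo i + (N - i.+1))%N) //=; last first.
    by have := le_lo i; have := ltn_ord i; rewrite /dd; lia.
  rewrite addrAC subrr add0r big_addn.
  have -> : ((dd lam i).+1 - (N - i.+1) = (lam i).+1)%N.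
    by have := ltn_ord i; rewrite /dd; lia.
  rewrite (big_nat_widen _ _ B.+1) ?ltnS //.
  rewrite (big_nat_widenl _ 0%N) // big_mkord.
  by apply: eq_bigl => m; rewrite /dom /= ltnS andbC.
have strip_dom (f : {ffun 'I_N -> 'I_B.+1}) :
    hstrip [ffun i => lam i] [ffun i => val (f i)] = (f \in family dom).
  apply/andP/familyP => [[/forallP le1 /forallP le2] i | fam].
    rewrite unfold_in /dom; have := le1 i; rewrite !ffunE => ->; rewrite andbT.
    rewrite /lo; case: insubP => //= i' _ Ei; have /forallP /(_ i') := le2 i.
    by rewrite Ei ltnSn !ffunE.
  split; apply/forallP => i; first by have := fam i; rewrite unfold_in /dom !ffunE => /andP[].
  apply/forallP => j; apply/implyP => lt_ij; rewrite !ffunE.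
  have := fam i; rewrite unfold_in /dom /dom => /andP[+ _]; apply: leq_trans.
  rewrite /lo; case: insubP => [i' _ Ei|] /=; first by apply: lamP; rewrite Ei.
  by rewrite -leqNgt => le_N; have := ltn_ord j; lia.
rewrite /determinant; under [RHS]eq_bigr => s _.
  under eq_bigr => i _ do rewrite LPhi.
  rewrite bigA_distr_big_dep; over.
under [RHS]eq_bigr do rewrite big_distrr.
rewrite [RHS]exchange_big big_filter big_image_cond /=.
apply: eq_big => [f|f _]; first by rewrite strip_dom.
rewrite /qdet /determinant big_distrr; apply: eq_bigr => s _ /=.
rewrite mulrCA; congr (_ * _); rewrite -prodrXr -big_split /=.
apply: eq_bigr => i _; rewrite mxE /G /h.
suff -> : dd [ffun r => val (f r)] i = (f i + (N - i.+1))%N by [].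
by rewrite /dd ffunE addnBA.
Qed.

Lemma hstrip_part lam (nu : {ffun 'I_N -> nat}) :
  is_part lam -> hstrip [ffun i => lam i] nu -> is_part nu.
Proof.
move=> lamP /andP[/forallP le1 /forallP le2] i j; rewrite leq_eqVlt.
case/predU1P => [/val_inj->//|lt_ij].
have /forallP/(_ j)/implyP/(_ lt_ij) := le2 i; apply: leq_trans.
exact: le1.
Qed.

(** Insert [qdet_hooks] on both sides of [qdet_interlace]. The staircase N - i - 1 inside [dd]
    contributes the same power of q to each side and cancels. *)
Lemma hook_recursion lam : is_part lam ->
  \sum_(nu <- hstrips [ffun i => lam i]) q ^+ (colsum nu + content nu) / hook_prod nu =
  q ^+ content lam / hook_prod lam.
Proof.
move=> lamP; pose kappa := (\sum_(j < N) j * (N - j.+1))%N.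
have ddE mu : (\sum_(j < N) j * dd mu j = content mu + kappa)%N.
  rewrite -big_split; apply: eq_bigr => j _ /=.
  by rewrite -mulnDr /dd addnBA.
have sumE (nu : {ffun 'I_N -> nat}) : (\sum_i dd nu i = colsum nu + \sum_(j < N) j)%N.
  rewrite [X in (_ + X)%N](reindex_inj rev_ord_inj) -big_split /=.
  by apply: eq_bigr => i _; rewrite /dd addnBA.
have := qdet_interlace lamP; rewrite qdet_hooks // ddE.
rewrite (eq_big_seq (fun nu : {ffun 'I_N -> nat} => q ^+ (\sum_(j < N) j) * q ^+ kappa *
    (q ^+ (colsum nu + content nu) / hook_prod nu))); last first.
  move=> nu; rewrite mem_hstrips => /(hstrip_part lamP) nuP.
  by rewrite qdet_hooks // ddE sumE !exprD; ring.
rewrite -big_distrr /= -mulrA => /mulfI E.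
apply: (mulfI (expf_neq0 kappa q_neq0)); rewrite E ?expf_neq0 //.
by rewrite exprD mulrA [_ ^+ _ * _ ^+ _]mulrC.
Qed.
End HookDet.

(** * Hilbert series of O_lambda and the number of tableaux *)

Section Counting.
Variable N : nat.
Implicit Type lam : 'I_N -> nat.

Definition hook lam (v : 'I_(nvar lam)) : nat := (val (enum_val v : Idx lam)).2.

Lemma dd_le_Dmax lam r : (dd lam r <= Dmax lam)%N.
Proof. exact: leq_bigmax. Qed.

Lemma hook_gt0 lam (v : 'I_(nvar lam)) : (0 < hook v)%N.
Proof. by rewrite /hook; case: (enum_val v) => p /= /andP[/andP[]]. Qed.

Lemma prod_hook (A : comPzRingType) (g : nat -> A) lam :
  \prod_(v < nvar lam) g (hook v) =
  \prod_(r < N) \prod_(1 <= j < (dd lam r).+1 |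
     ~~ [exists r', dd lam r' == (dd lam r - j)%N]) g j.
Proof.
rewrite /hook -(big_enum_val (fun x : Idx lam => g (val x).2)) /=.
transitivity (\prod_(p | @idx_pred N lam p) g p.2).
  rewrite (reindex_omap val (insub : _ -> option (Idx lam))) /=.
    by apply: eq_bigl => x; rewrite valK eqxx (valP x).
  by move=> p Pp; rewrite insubT.
rewrite /idx_pred -(pair_big_dep xpredT (fun r (j : 'I_(Dmax lam).+1) =>
  (1 <= j <= dd lam r)%N && ~~ [exists r', dd lam r' == (dd lam r - j)%N])
  (fun _ j => g j)) /=.
apply: eq_bigr => r _.
rewrite (big_nat_widen _ _ (Dmax lam).+1) ?ltnS ?dd_le_Dmax //.
rewrite (big_nat_widenl _ 0%N) // big_mkord; apply: eq_bigl => j.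
by rewrite ltnS andbC -andbA; congr (_ && _); rewrite andbC.
Qed.

Local Notation q := (tofrac ('X : {poly rat})).

Lemma fracX_neq0 : q != 0.
Proof. by rewrite tofrac_eq0 polyX_eq0. Qed.

Lemma fracX_generic m : 1 - q ^+ m.+1 != 0.
Proof.
rewrite -tofracXn -tofrac1 -tofracB tofrac_eq0.
apply/eqP => /(congr1 (fun p : {poly rat} => p`_0)) /eqP.
by rewrite coefB coef1 coefXn coef0 subr0 oner_eq0.
Qed.

(** The local ring at X = 0: congruences modulo powers of X inside it take the place of power series
    expansions. *)
Definition regular0 (x : {fraction {poly rat}}) :=
  exists n d : {poly rat}, d`_0 != 0 /\ x * tofrac d = tofrac n.

Lemma regular0_frac (p : {poly rat}) : regular0 (tofrac p).
Proof. by exists p, 1; rewrite coef1 oner_eq0 rmorph1 mulr1. Qed.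

Lemma regular0D x y : regular0 x -> regular0 y -> regular0 (x + y).
Proof.
move=> [n [d [d0 xE]]] [n' [d' [d'0 yE]]]; exists (n * d' + n' * d), (d * d').
by rewrite coef0M mulf_neq0 //; split=> //; rewrite !rmorphD !rmorphM /= -xE -yE; ring.
Qed.

Lemma regular0M x y : regular0 x -> regular0 y -> regular0 (x * y).
Proof.
move=> [n [d [d0 xE]]] [n' [d' [d'0 yE]]]; exists (n * n'), (d * d').
by rewrite coef0M mulf_neq0 //; split=> //; rewrite !rmorphM /= -xE -yE; ring.
Qed.

(** Clearing the denominator d gives p d = X^(B+1) n; as d(0) is nonzero, the coefficients of p
    vanish one after the other. *)
Lemma regular0_coef (p : {poly rat}) B y : regular0 y ->
  tofrac p = q ^+ B.+1 * y -> forall m, (m <= B)%N -> p`_m = 0.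
Proof.
move=> [n [d [d0 yE]]] pE.
have E : p * d = 'X^(B.+1) * n.
  by apply/eqP; rewrite -tofrac_eq !tofracM pE -mulrA yE tofracXn.
elim/ltn_ind => m IH lt_m; have := congr1 (fun r : {poly rat} => r`_m) E.
rewrite coefXnM ltnS lt_m coefM big_ord_recr /= subnn big1 ?add0r.
  by move/eqP; rewrite mulf_eq0 (negPf d0) orbF => /eqP.
by move=> l _; rewrite IH ?mul0r //; have := ltn_ord l; lia.
Qed.

(** The Hilbert series of O_lambda with every geometric series cut after B + 1 terms. *)
Definition genf lam B : {poly rat} := \prod_(v < nvar lam) \sum_(m < B.+1) 'X^(m * hook v).

(** Each factor times 1 - X^h is 1 - X^(h(B+1)), and h(B+1) >= b + 1 because h is positive. *)
Lemma genfE lam B b : (b <= B)%N -> exists2 y, regular0 y &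
  tofrac (genf lam B) = (hook_prod q lam)^-1 + q ^+ b.+1 * y.
Proof.
move=> le_bB; pose D : {poly rat} := \prod_(v < nvar lam) (1 - 'X^(hook v)).
have DE : tofrac D = hook_prod q lam.
  rewrite rmorph_prod /hook_prod -(prod_hook (fun j => 1 - q ^+ j)).
  by apply: eq_bigr => v _; rewrite rmorphB rmorph1 rmorphXn.
have [R RE] : exists R, D * genf lam B = 1 + 'X^(b.+1) * R.
  rewrite -big_split /=.
  apply: (big_ind (fun x : {poly rat} => exists R, x = 1 + 'X^(b.+1) * R)).
  - by exists 0; rewrite mulr0 addr0.
  - move=> _ _ [R ->] [R' ->]; exists (R + R' + 'X^(b.+1) * R * R'); ring.
  move=> v _; exists (- 'X^(hook v * B.+1 - b.+1)).
  have -> : \sum_(m < B.+1) 'X^(m * hook v) = \sum_(m < B.+1) 'X^(hook v) ^+ m :> {poly rat}.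
    by apply: eq_bigr => m _; rewrite -exprM mulnC.
  rewrite mulrN -exprD subnKC; last by have := hook_gt0 v; nia.
  by rewrite -opprB mulNr -subrX1 opprB -exprM.
have H0 : hook_prod q lam != 0 by apply: hook_prod_neq0; exact: fracX_generic.
exists (tofrac R / hook_prod q lam).
  exists R, D; split; last by rewrite DE mulfVK.
  by rewrite coef0_prod; apply/prodf_neq0 => v _;
    rewrite coefB coef1 coefXn (ltn_eqF (hook_gt0 v)) subr0 oner_eq0.
have := congr1 (@tofrac _) RE; rewrite tofracM tofracD tofracM DE tofrac1 tofracXn => E.
by apply: (mulfI H0); rewrite E mulrDr divff // mulrCA [_ * (_ / _)]mulrCA divff // mulr1.
Qed.

(** Bounding exponents by k loses nothing, all degrees being positive: this is the dimension of the
    part of O_lambda of degree k - n(lambda). *)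
Definition count_monom lam k :=
  #|[set f : {ffun 'I_(nvar lam) -> 'I_k.+1} | (\sum_v f v * hook v + content lam == k)%N]|.

(** For B = k, expand the product; by [genfE] another truncation changes the polynomial only from
    X^(k+1) on. *)
Lemma count_monomE lam k B : (k <= B)%N ->
  (count_monom lam k)%:R = ('X^(content lam) * genf lam B)`_k.
Proof.
move=> le_kB; transitivity ('X^(content lam) * genf lam k)`_k.
  rewrite /genf bigA_distr_bigA /= big_distrr coef_sum /= /count_monom -sum1_card natr_sum.
  rewrite big_mkcond; apply: eq_bigr => f _.
  rewrite inE prodrXr -exprD coefXn addnC eq_sym.
  by case: eqP.
have [y Ry Ey] := genfE lam (leqnn k); have [y' Ry' Ey'] := genfE lam le_kB.
rewrite !coefXnM; case: ltnP => // le_ck.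
apply/eqP; rewrite -subr_eq0 -coefB; apply/eqP.
apply: (@regular0_coef _ k (y + tofrac (-1) * y')); last exact: leq_subr.
  by apply: regular0D => //; apply: regular0M => //; exact: regular0_frac.
by rewrite tofracB Ey Ey' tofracN tofrac1; ring.
Qed.

(** This is the coefficient of X^k in [hook_recursion], with the fractions replaced by [genf] modulo
    X^(k+1). *)
Lemma count_monom_rec lam k : is_part lam ->
  count_monom lam k =
  (\sum_(nu <- hstrips [ffun i => lam i] | colsum nu <= k)
     count_monom nu (k - colsum nu))%N.
Proof.
move=> lamP; apply/eqP; rewrite -(eqr_nat rat) natr_sum (count_monomE lam (leqnn k)).
pose g nu := 'X^(content nu) * genf nu k.
have -> : \sum_(nu <- hstrips [ffun i => lam i] | (colsum nu <= k)%N)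
     (count_monom nu (k - colsum nu))%:R =
   (\sum_(nu <- hstrips [ffun i => lam i]) 'X^(colsum nu) * g nu)`_k.
  rewrite coef_sum big_mkcond; apply: eq_bigr => nu _.
  rewrite coefXnM ltnNge; case: leqP => //= le_k.
  by rewrite (count_monomE nu (leq_subr _ k)).
rewrite -subr_eq0 -coefB; apply/eqP.
have [y Ry Ey] := genfE lam (leqnn k).
have gE nu : exists2 z, regular0 z & tofrac ('X^(colsum nu) * g nu) =
    q ^+ (colsum nu + content nu) / hook_prod q nu + q ^+ k.+1 * z.
  have [z Rz Ez] := genfE nu (leqnn k); exists (tofrac 'X^(colsum nu + content nu) * z).
    by apply: regular0M => //; exact: regular0_frac.
  by rewrite /g !tofracM Ez !tofracXn exprD; ring.
have [z Rz Ez] : exists2 z, regular0 z &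
    tofrac (\sum_(nu <- hstrips [ffun i => lam i]) 'X^(colsum nu) * g nu) =
    q ^+ content lam / hook_prod q lam + q ^+ k.+1 * z.
  rewrite -(hook_recursion fracX_neq0 fracX_generic lamP).
  elim: (hstrips _) => [|nu s [z Rz IH]].
    exists (tofrac 0); first exact: regular0_frac.
    by rewrite !big_nil tofrac0 mulr0 addr0.
  have [z' Rz' Ez'] := gE nu; exists (z' + z); first exact: regular0D.
  by rewrite !big_cons tofracD IH Ez'; ring.
apply: (@regular0_coef _ k (tofrac 'X^(content lam) * y + tofrac (-1) * z)) => //.
  by apply: regular0D; apply: regular0M => //; exact: regular0_frac.
by rewrite tofracB tofracM Ez Ey !tofracXn tofracN tofrac1; ring.
Qed.

(** Both sides obey the same recursion over horizontal strips. For small [K] the bound on the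
    entries excludes tableaux, hence only an inequality. *)
Lemma size_ssyt K lam k : is_part lam ->
  (size (ssyt K [ffun i => lam i] k) <= count_monom lam k)%N.
Proof.
elim: K lam k => [|K IH] lam k lamP /=.
  case: ifP => // /andP[/eqP lam0 /eqP->]; rewrite card_gt0; apply/set0Pn.
  exists [ffun=> ord0]; rewrite inE big1 => [|v _]; last by rewrite ffunE.
  rewrite add0n /content big1 // => i _; suff -> : lam i = 0%N by rewrite muln0.
  by apply/eqP; rewrite -leqn0 -lam0 /colsum (bigD1 i) //= ffunE leq_addr.
rewrite count_monom_rec // size_flatten /shape -map_comp sumnE big_map big_filter.
rewrite [leqLHS]big_seq_cond [leqRHS]big_seq_cond leq_sum // => nu /andP[+ _].
rewrite mem_hstrips => /(hstrip_part lamP) nuP /=.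
rewrite size_map; apply: leq_trans (IH nu _ nuP).
by rewrite (_ : [ffun i => nu i] = nu) //; apply/ffunP => i; rewrite ffunE.
Qed.

End Counting.

(** * Invariant vectors as functions on words, and singular vectors as highest weight vectors *)

Section Words.
Variables (C : numFieldType) (N n : nat).
Local Notation letter := ('I_N * nat)%type.
Local Notation col := {ffun 'I_N -> nat}.
Implicit Types (x : Vec C N n) (b : Tn N n) (m : 'X_{1..n}) (L : seq letter).
Implicit Types (i j r : 'I_N) (k : nat) (w : seq col).

(** A letter (i, k) stands for the basis vector v_i with z^k in one tensor slot. Lists of the wrong
    length get 0, which makes the function total. *)
Definition wordcoef x L : C :=
  oapp (fun t : n.-tuple letter =>
    (coord x [ffun s => (tnth t s).1])@_[multinom (tnth t s).2 | s < n]) 0 (insub L).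

Definition word b m : seq letter := [seq (b s, m s) | s <- enum 'I_n].

Lemma size_word b m : size (word b m) = n.
Proof. by rewrite size_map size_enum_ord. Qed.

Lemma wordE L : size L = n -> exists b m, L = word b m.
Proof.
move=> /eqP sL; pose t := Tuple sL.
exists [ffun s => (tnth t s).1], [multinom (tnth t s).2 | s < n].
rewrite /word -[LHS](map_tnth_enum t); apply: eq_map => s.
by rewrite ffunE mnmE -surjective_pairing.
Qed.

Lemma wordcoef_word x b m : wordcoef x (word b m) = (coord x b)@_m.
Proof.
rewrite /wordcoef insubT /=; first by rewrite size_word eqxx.
move=> sz; congr (mcoeff _ (coord x _)).
  by apply/mnmP => s; rewrite mnmE (tnth_nth (b s, m s)) /= (nth_map s) ?size_enum_ord // nth_ord_enum.
by apply/ffunP => s; rewrite ffunE (tnth_nth (b s, m s)) /= (nth_map s) ?size_enum_ord // nth_ord_enum.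
Qed.

Lemma wordcoef_size x L : wordcoef x L != 0 -> size L = n.
Proof. by rewrite /wordcoef; case: insubP => [t /eqP//|_]; rewrite eqxx. Qed.

Lemma coordD x y b : coord (x + y) b = coord x b + coord y b.
Proof. by rewrite /coord mxE. Qed.

Lemma coordZ (p : Poly C n) x b : coord (p *: x) b = p * coord x b.
Proof. by rewrite /coord mxE. Qed.

Lemma wordcoef_lin (a : C) x y L :
  wordcoef (a%:MP *: x + y) L = a * wordcoef x L + wordcoef y L.
Proof.
rewrite /wordcoef; case: insub => [t|] /=; last by rewrite mulr0 addr0.
by rewrite coordD coordZ mcoeffD mcoeffCM.
Qed.

Lemma wordcoef0 L : wordcoef 0 L = 0.
Proof.
by rewrite /wordcoef; case: insub => [t|] //=; rewrite /coord mxE mcoeff0.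
Qed.

Lemma wordcoef_sum (I : finType) (a : I -> C) (X : I -> Vec C N n) L :
  wordcoef (\sum_i (a i)%:MP *: X i) L = \sum_i a i * wordcoef (X i) L.
Proof.
elim: (index_enum I) => [|i s IH]; first by rewrite !big_nil wordcoef0.
by rewrite !big_cons wordcoef_lin IH.
Qed.

(** An invariant vector is a symmetric tensor over V[z], so only the multiset of letters matters. *)
Lemma wordcoef_perm x L L' : Sn_invariant x -> perm_eq L L' ->
  wordcoef x L = wordcoef x L'.
Proof.
move=> xS LL'; have [sz|sz] := eqVneq (size L') n; last first.
  by rewrite /wordcoef !insubN ?(perm_size LL').
pose t : n.-tuple letter := tcast sz (in_tuple L').
have L't : L' = t by rewrite val_tcast.
move: LL'; rewrite L't => /tuple_permP[p ->].
rewrite /wordcoef !valK /= [in RHS](xS p) mcoeff_sym; congr (mcoeff _ (coord x _)).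
  by apply/mnmP => s; rewrite !mnmE tnth_mktuple.
by apply/ffunP => s; rewrite !ffunE tnth_mktuple.
Qed.

Definition subst b (s : 'I_n) j : Tn N n := [ffun t => if t == s then j else b t].

Lemma glactE i j x b :
  coord (glact C n i j *m x) b = \sum_(s | b s == i) coord x (subst b s j).
Proof.
rewrite /coord mxE /glact.
transitivity (\sum_(s < n) \sum_a Eop C s i j (enum_rank b) a * x a 0).
  rewrite exchange_big; apply: eq_bigr => a _.
  by rewrite summxE mulr_suml.
rewrite [RHS]big_mkcond; apply: eq_bigr => s _.
rewrite (bigD1 (enum_rank (subst b s j))) //= big1 ?addr0 => [|a].
  rewrite mxE !enum_rankK ffunE eqxx eqxx andbT.
  have -> : (b == [ffun t => if t == s then i else (subst b s j) t]) = (b s == i).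
    apply/eqP/eqP => [->|bs]; first by rewrite ffunE eqxx.
    by apply/ffunP => t; rewrite !ffunE; case: eqP => [->|].
  by case: eqP; rewrite (mul1r, mul0r).
move=> a_neq; rewrite mxE enum_rankK; case: andP => [[/eqP bE /eqP aj]|_]; last exact: mul0r.
case/negP: a_neq; rewrite -(enum_valK a); apply/eqP; congr enum_rank.
apply/ffunP => t; rewrite ffunE; case: eqP => [->//|/eqP ts].
by rewrite bE ffunE (negPf ts).
Qed.

Lemma word_subst b m s j :
  perm_eq (word (subst b s j) m) ((j, m s) :: rem (b s, m s) (word b m)).
Proof.
have enum_s : perm_eq (enum 'I_n) (s :: rem s (enum 'I_n)) by rewrite perm_to_rem ?mem_enum.
have wb : perm_eq (word b m) ((b s, m s) :: [seq (b t, m t) | t <- rem s (enum 'I_n)]).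
  exact: (perm_map (fun t => (b t, m t)) enum_s).
have ws := perm_map (fun t => (subst b s j t, m t)) enum_s.
apply: (perm_trans ws); rewrite /= [subst b s j s]ffunE eqxx perm_cons.
have in_w : (b s, m s) \in word b m by apply/mapP; exists s; rewrite ?mem_enum.
have := perm_to_rem in_w; rewrite perm_sym => wr.
have := perm_trans wr wb; rewrite perm_cons perm_sym => /(perm_trans _); apply.
suff /eq_in_map -> : {in rem s (enum 'I_n), forall t,
  (subst b s j t, m t) = (b t, m t)} by [].
move=> t; rewrite mem_rem_uniq ?enum_uniq // inE => /andP[ts _].
by rewrite ffunE (negPf ts).
Qed.

Lemma wordcoef_raise i j x L : Sn_invariant x -> glact C n i j *m x = 0 ->
  size L = n ->
  \sum_(y <- L | y.1 == i) wordcoef x ((j, y.2) :: rem y L) = 0.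
Proof.
move=> xS Ex /wordE[b [m ->]].
have := congr1 (fun z => (coord z b)@_m) Ex.
rewrite /= glactE raddf_sum /= [RHS](_ : _ = 0); last by rewrite /coord mxE mcoeff0.
move=> E0; rewrite big_map big_enum_cond /= -[RHS]E0; apply: eq_bigr => s _.
by rewrite -wordcoef_word; apply: wordcoef_perm => //; rewrite perm_sym word_subst.
Qed.

Lemma wordcoef_weight x L (lam : 'I_N -> nat) r :
  glact C n r r *m x = (lam r)%:R *: x -> wordcoef x L != 0 ->
  count (fun y => y.1 == r) L = lam r.
Proof.
move=> Ex xL; have [b [m LE]] := wordE (wordcoef_size xL).
move: xL; rewrite LE wordcoef_word => xb.
have := congr1 (fun z => (coord z b)@_m) Ex.
rewrite /= glactE coordZ mulr_natl mcoeffMn (eq_bigr (fun=> coord x b)); last first.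
  move=> s /eqP bs; congr (coord x); apply/ffunP => t; rewrite ffunE.
  by case: eqP => [->|].
rewrite sumr_const mcoeffMn -[LHS]mulr_natl -[RHS]mulr_natl => /(mulIf xb) /eqP.
rewrite eqr_nat => /eqP <-.
by rewrite count_map -sum1_card -sum1_count big_enum_cond.
Qed.

Lemma wordcoef_degree x L k : homogV k x -> wordcoef x L != 0 ->
  (\sum_(y <- L) y.2)%N = k.
Proof.
move=> xk xL; have [b [m LE]] := wordE (wordcoef_size xL).
move: xL; rewrite LE wordcoef_word -mcoeff_msupp => /xk <-.
by rewrite big_map big_enum mdegE.
Qed.

Definition collist k (a : col) : seq letter := flatten [seq nseq (a i) (i, k) | i <- enum 'I_N].

Fixpoint letters k w := if w is a :: w' then collist k a ++ letters k.+1 w' else [::].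

Lemma count_collist (P : pred letter) k a :
  count P (collist k a) = (\sum_i P (i, k) * a i)%N.
Proof.
rewrite count_flatten sumnE -map_comp big_map big_enum.
by apply: eq_bigr => i _; rewrite /= count_nseq.
Qed.

Lemma mem_collist k a y : y \in collist k a -> y.2 = k.
Proof. by case/flattenP => s /mapP[i _ ->] /nseqP[->]. Qed.

Lemma count_row k a r : count (fun y => y.1 == r) (collist k a) = a r.
Proof.
rewrite count_collist (bigD1 r) //= eqxx mul1n big1 ?addn0 // => i /negPf ->.
exact: mul0n.
Qed.

Lemma count_letters_row k w r : count (fun y => y.1 == r) (letters k w) = colwt w r.
Proof.
elim: w k => [|a w IH] k /=; first by rewrite /colwt big_nil.
by rewrite count_cat IH count_row colwt_cons.
Qed.

Lemma letters_degree k w :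
  (\sum_(y <- letters k w) y.2 = coldeg w + k * \sum_(b <- w) colsum b)%N.
Proof.
elim: w k => [|a w IH] k /=; first by rewrite !big_nil muln0.
rewrite big_cat IH big_cons /=.
have -> : (\sum_(y <- collist k a) y.2 = k * colsum a)%N.
  rewrite big_seq_cond (eq_bigr (fun=> k)) => [|y]; last by rewrite andbT => /mem_collist.
  rewrite -big_seq_cond big_const_seq iter_addn_0 count_predT; congr (_ * _)%N.
  rewrite -count_predT count_collist; by apply: eq_bigr => i _; rewrite mul1n.
by rewrite mulnDr mulSn; lia.
Qed.

Lemma count_mem_letters k w r l : count_mem (r, l) (letters k w) =
  if (k <= l)%N then nth [ffun=> 0%N] w (l - k) r else 0%N.
Proof.
elim: w k => [|a w IH] k /=; first by rewrite nth_nil ffunE; case: ifP.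
rewrite count_cat IH count_collist (bigD1 r) //= big1 ?addn0 => [|i /negPf ir]; last first.
  by rewrite xpair_eqE ir.
rewrite xpair_eqE eqxx /=; case: (ltngtP k l) => [lt_kl|lt_lk|->].
- by rewrite mul0n add0n -(subnSK lt_kl).
- by rewrite mul0n.
- by rewrite subnn mul1n addn0.
Qed.

(** The [a i] equal letters of a column give equal terms, whence the factor [a i] in [raise]. The
    prefix [pre] carries the columns already passed. *)
Lemma raise_letters i j (f : seq letter -> C) pre k w : i != j ->
  (forall L L', perm_eq L L' -> f L = f L') ->
  raise i j (fun v => f (pre ++ letters k v)) w =
  \sum_(y <- letters k w | y.1 == i) f (pre ++ (j, y.2) :: rem y (letters k w)).
Proof.
move=> ij fP; elim: w pre k => [|a w IH] pre k /=; first by rewrite big_nil.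
have -> : (fun v => f (pre ++ collist k a ++ letters k.+1 v)) =
    (fun v => f ((pre ++ collist k a) ++ letters k.+1 v)).
  by apply: functional_extensionality => v; rewrite catA.
rewrite IH big_cat; congr (_ + _); last first.
  rewrite [LHS]big_seq_cond [RHS]big_seq_cond; apply: eq_bigr => y /andP[y_w _].
  apply: fP; rewrite -catA perm_cat2l.
  rewrite perm_catC /= perm_cons -(perm_cons y) -cat_cons.
  apply: (@perm_trans _ (letters k.+1 w ++ collist k a)).
    by rewrite perm_cat2r perm_sym perm_to_rem.
  by rewrite perm_catC perm_to_rem // mem_cat y_w orbT.
rewrite big_seq_cond (eq_bigr (fun=> f (pre ++ (j, k) :: rem (i, k) (collist k a ++ letters k.+1 w)))).
  rewrite -big_seq_cond big_const_seq iter_addr_0 count_row -[RHS]mulr_natl.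
  have [->|ai] := posnP (a i); first by rewrite !mul0r.
  congr (_ * _); apply: fP; rewrite perm_cat2l.
  have ik : (i, k) \in collist k a ++ letters k.+1 w.
    rewrite mem_cat; apply/orP; left; rewrite -has_pred1 has_count count_collist (bigD1 i) //=.
    by rewrite eqxx mul1n ltn_addr.
  rewrite -(perm_cons (i, k)); apply: (@perm_trans _ ((j, k) :: (collist k a ++ letters k.+1 w))).
    apply/seq.permP => P; rewrite /= !count_cat !addnA; congr (_ + _)%N.
    rewrite !count_collist (bigD1 i) // [in RHS](bigD1 i) //= (bigD1 j) 1?eq_sym //=.
    rewrite [in RHS](bigD1 j) 1?eq_sym //= !ffunE !eqxx (negPf ij) eq_sym (negPf ij).
    rewrite (eq_bigr (fun r : 'I_N => P (r, k) * a r)%N).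
      by rewrite !subn0 !addn0 mulnBr mulnDr !muln1; case: (P (i, k)) => /=; lia.
    by move=> r /andP[/negPf ri /negPf rj]; rewrite ffunE ri rj subn0 addn0.
  apply: (@perm_trans _ ((j, k) :: (i, k) :: rem (i, k) (collist k a ++ letters k.+1 w))).
    by rewrite perm_cons perm_to_rem.
  exact/permEl/(perm_catCA [:: (j, k)] [:: (i, k)]).
move=> y /andP[y_a /eqP yi]; have yk := mem_collist y_a.
by rewrite yk (surjective_pairing y) yi yk.
Qed.

(** Appending empty columns does not change the word; fixing the number of columns selects one
    representative. *)
Definition colcoef K x w := if size w == K then wordcoef x (letters 0 w) else 0.

Lemma raise_size i j K (f : seq col -> C) w :
  raise i j (fun v => if size v == K then f v else 0) w =
  if size w == K then raise i j f w else 0.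
Proof.
elim: w K f => [|a w IH] K f /=; first by case: ifP.
case: K => [|K].
  rewrite (_ : (fun v => _) = fun=> 0) ?raise0 ?mulr0 ?addr0 //.
by rewrite eqSS IH; case: ifP => //; rewrite mulr0 addr0.
Qed.

Lemma singular_determined x (lam : 'I_N -> nat) k : inM lam x -> homogV k x ->
  (forall w, w \in ssyt k.+1 [ffun i => lam i] k -> wordcoef x (letters 0 w) = 0) -> x = 0.
Proof.
move=> [xS xwt xE] xk x0.
(* In degree k all exponents are at most k, so k + 1 columns suffice. *)
have c0 : forall w, colcoef k.+1 x w = 0.
  apply: (@ssyt_determine C N k.+1 [ffun i => lam i] k).
  - move=> w; rewrite /colcoef; case: (size w =P k.+1) => [sw|_]; last by case/eqP.
    move=> xw; split=> //.
      by move=> r; rewrite -(count_letters_row 0) (wordcoef_weight (xwt r) xw) ffunE.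
    by have := wordcoef_degree xk xw; rewrite letters_degree mul0n addn0.
  - move=> i j lt_ij w; rewrite raise_size; case: ifP => // _.
    have ij : i != j by rewrite neq_ltn lt_ij.
    have := raise_letters [::] 0 w ij (fun L L' => @wordcoef_perm x L L' xS).
    rewrite /= => ->; have [sz|sz] := eqVneq (size (letters 0 w)) n.
      by rewrite wordcoef_raise ?xE.
    rewrite big_seq_cond big1 // => y /andP[y_w _]; apply: contraNeq sz => /wordcoef_size /=.
    rewrite size_rem // prednK; first by move=> ->.
    by case: (letters 0 w) y_w.
  - by move=> w w_in; rewrite /colcoef x0 ?if_same.
apply/matrixP => a l; rewrite (ord1 l) mxE -(enum_valK a); apply/mpolyP => m.
rewrite mcoeff0 -/(coord x (enum_val a)) -wordcoef_word.
set L := word _ _; apply: contraTeq isT => xL.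
have degL : (\sum_(y <- L) y.2)%N = k := wordcoef_degree xk xL.
(* Sort the word into columns of multiplicities; this permutes its letters and keeps the
   coefficient. *)
pose w : seq col := mkseq (fun l => [ffun i => count_mem (i, l) L]) k.+1.
move: xL; rewrite (@wordcoef_perm _ L (letters 0 w)) //.
  by have := c0 w; rewrite /colcoef size_mkseq eqxx => ->; rewrite eqxx.
rewrite /perm_eq; apply/allP => -[r d] _; rewrite inE count_mem_letters leq0n subn0.
have [lt_d|le_d] := ltnP d k.+1; first by rewrite nth_mkseq // ffunE.
rewrite nth_default ?size_mkseq // ffunE; apply/eqP/count_memPn; apply/negP => rd.
by move: degL; rewrite (big_rem _ rd) /=; lia.
Qed.

End Words.

(** * Symmetric polynomials are generated by power sums *)

Section PowerSums.
Variables (C : numFieldType) (n : nat).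
Local Notation P := {mpoly C[n]}.

Variable Q : P -> Prop.
Hypothesis QC : forall c : C, Q c%:MP.
Hypothesis QD : forall p p', Q p -> Q p' -> Q (p + p').
Hypothesis QM : forall p p', Q p -> Q p' -> Q (p * p').
Hypothesis Q_powersum : forall k, Q (\sum_(s < n) 'X_s ^+ k).

(** Newton's identities in the form p_i e_j = T_(i,j) + T_(i+1,j-1) and (j+1) e_(j+1) = T_(1,j),
    where T_(i,j) sums z_s^i z_h over j-subsets h avoiding s. The induction treats e_k and all
    T_(i,k) together. *)
Lemma mesym_powersum k : Q (mesym n C k).
Proof.
pose zh (h : {set 'I_n}) : P := \prod_(i in h) 'X_i.
pose T i k := \sum_(s < n) \sum_(h : {set 'I_n} | (s \notin h) && (#|h| == k)) 'X_s ^+ i * zh h.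
have QN p : Q p -> Q (- p) by move=> Qp; rewrite -mulN1r -mpolyCN; apply: QM.
have reidx (F : 'I_n -> {set 'I_n} -> P) j :
    \sum_(s < n) \sum_(h : {set 'I_n} | (s \in h) && (#|h| == j.+1)) F s h =
    \sum_(s < n) \sum_(h : {set 'I_n} | (s \notin h) && (#|h| == j)) F s (s |: h).
  apply: eq_bigr => s _; rewrite (reindex_onto (fun h => s |: h) (fun h => h :\ s)) /=; last first.
    by move=> h /andP[sh _]; rewrite setD1K.
  apply: eq_bigl => h; rewrite setU11 cardsU1 /=.
  case: (boolP (s \in h)) => sh /=; last by rewrite eqSS setU1K // eqxx andbT.
  by apply/negP => /andP[_ /eqP E]; move: sh; rewrite -E setD11.
have pE i j : (\sum_(s < n) 'X_s ^+ i) * mesym n C j = T i j + (if j is j'.+1 then T i.+1 j' else 0).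
  rewrite /mesym mulr_suml /T.
  under eq_bigr => s _ do rewrite mulr_sumr (bigID (fun h : {set 'I_n} => s \notin h)) /=.
  rewrite big_split /=; congr (_ + _).
    by apply: eq_bigr => s _; apply: eq_bigl => h; rewrite andbC.
  case: j => [|j].
    rewrite big1 // => s _; rewrite big1 // => h /andP[/eqP/cards0_eq-> ].
    by rewrite inE.
  transitivity (\sum_(s < n) \sum_(h : {set 'I_n} | (s \in h) && (#|h| == j.+1)) 'X_s ^+ i * zh h).
    by apply: eq_bigr => s _; apply: eq_bigl => h; rewrite negbK andbC.
  rewrite reidx; apply: eq_bigr => s _; apply: eq_bigr => h /andP[sh _].
  by rewrite /zh big_setU1 //= mulrA -exprSr.
have eT j : (j.+1)%:R * mesym n C j.+1 = T 1%N j.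
  transitivity (\sum_(s < n) \sum_(h : {set 'I_n} | (s \in h) && (#|h| == j.+1)) zh h).
    rewrite (exchange_big_dep (fun h : {set 'I_n} => #|h| == j.+1)) /=; last first.
      by move=> s h _ /andP[].
    rewrite /mesym mulr_sumr; apply: eq_bigr => h /eqP hj.
    rewrite [RHS](eq_bigl (fun s => s \in h)) => [|s]; last by rewrite hj eqxx andbT.
    by rewrite sumr_const hj mulr_natl.
  rewrite reidx; apply: eq_bigr => s _; apply: eq_bigr => h /andP[sh _].
  by rewrite /zh big_setU1 //= expr1.
suff [] : Q (mesym n C k) /\ forall i, Q (T i k) by [].
elim: k => [|k [IHe IHT]].
  have e0 : Q (mesym n C 0) by rewrite mesym0E -mpolyC1.
  split=> // i; have := pE i 0%N; rewrite addr0 => <-; exact: QM.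
have ek : Q (mesym n C k.+1).
  have -> : mesym n C k.+1 = (k.+1%:R^-1)%:MP * T 1%N k.
    rewrite -eT mulrA -[k.+1%:R : P]mpolyC_nat -mpolyCM mulVf ?mpolyC1 ?mul1r //.
    by rewrite pnatr_eq0.
  exact: QM.
split=> // i; have -> : T i k.+1 = (\sum_(s < n) 'X_s ^+ i) * mesym n C k.+1 - T i.+1 k.
  by rewrite pE addrK.
by apply: QD; [exact: QM | exact: QN].
Qed.

Lemma symmetric_powersum p : p \is symmetric -> Q p.
Proof.
move=> /sym_fundamental[t [<- _]]; elim/mpolyind: t => [|c m t _ _ IH].
  by rewrite comp_mpoly0 -mpolyC0.
rewrite comp_mpolyD comp_mpolyZ comp_mpolyX -mul_mpolyC; apply: QD => //.
apply: QM => //; apply: (big_ind Q) => [|//|i _]; first by rewrite -mpolyC1.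
rewrite tnth_mktuple; elim: (m i) => [|l IHl]; first by rewrite expr0 -mpolyC1.
by rewrite exprS; apply: QM => //; exact: mesym_powersum.
Qed.
End PowerSums.

(** * Roots, ranks and Cayley-Hamilton *)

(** Divide p by X while its constant term vanishes; the nonzero g stays a root, and then p(g) = 0
    shows that g divides the constant term. *)
Lemma root_low_coef (A : idomainType) (p : {poly A}) (g : A) :
  p != 0 -> root p g -> g != 0 -> exists m h, p`_m != 0 /\ p`_m = h * g.
Proof.
move=> + + g0; elim/poly_ind: p => [|p c IH]; first by rewrite eqxx.
have [-> | c0] := eqVneq c 0.
  rewrite addr0 mulf_eq0 negb_or => /andP[p0 _]; rewrite rootM => /orP[pg|].
    have [m [h [pm pmE]]] := IH p0 pg; exists m.+1, h.
    by rewrite coefMX.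
  by rewrite rootX (negPf g0).
move=> _ /eqP; rewrite !hornerE => /eqP; rewrite addr_eq0 => /eqP E.
exists 0%N, (- p.[g]); rewrite coefD coefMX coefC eqxx add0r.
by rewrite mulNr E opprK.
Qed.

Lemma row_inj_surj (K : fieldType) p q (E : 'M[K]_(p, q)) : (q <= p)%N ->
  (forall u : 'rV_p, u *m E = 0 -> u = 0) -> forall e : 'rV_q, exists u : 'rV_p, u *m E = e.
Proof.
move=> le_qp injE e; have freeE : row_free E.
  rewrite -kermx_eq0; apply/eqP/row_matrixP => i; rewrite row0; apply: injE.
  by rewrite -row_mul mulmx_ker row0.
have fullE : row_full E.
  have := rank_leq_col E; rewrite /row_full (eqP freeE) => le_pq.
  by rewrite eqn_leq le_pq le_qp.
by have /submxP[u ->] := submx_full e fullE; exists u.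
Qed.

Lemma mul_char_poly_kills (A : comNzRingType) m (M : 'M[A]_m) (p r : {poly A}) K (x : 'cV_m) :
  r = p * char_poly M -> (size r <= K)%N ->
  \sum_(i < K) r`_i *: iter i (mulmx M) x = 0.
Proof.
case: m M x => [|m] M x rE le_rK; first by rewrite [LHS]flatmx0 [RHS]flatmx0.
have : horner_mx M r = 0 by rewrite rE rmorphM /= Cayley_Hamilton mulr0.
have -> : r = \poly_(i < K) r`_i.
  apply/polyP => i; rewrite coef_poly; case: ltnP => // le_Ki.
  by rewrite nth_default // (leq_trans le_rK).
rewrite poly_def rmorph_sum /= => /(congr1 (mulmx^~ x)).
rewrite mul0mx mulmx_suml => E; rewrite -[RHS]E -poly_def; apply: eq_bigr => i _.
rewrite linearZ /= rmorphXn /= horner_mx_X -scalemxAl coef_poly ltn_ord; congr (_ *: _).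
elim: (i : nat) => [|k IH]; first by rewrite expr0 mul1mx.
by rewrite iterS IH exprS mulmxA.
Qed.

(** * Leading coefficients of products of first-order operators *)

Section RowDet.
Variables (A : pzRingType) (der : (nat -> A) -> nat -> A) (bnd : nat).
Hypothesis der0 : der (fun=> 0) = fun=> 0.
Hypothesis der1 : der (fun k => (k == 0%N)%:R) = fun=> 0.
Local Notation one_ser := (fun k : nat => (k == 0%N)%:R : A).

Definition order_le (X : dop A) p := forall r, (p < r)%N -> X r = fun=> 0.

Definition linfactor (c : bool) (e : nat -> A) : dop A := fun p k =>
  (if c && (p == 1%N) && (k == 0%N) then 1 else 0) - (if p == 0%N then e k else 0).

Lemma smul0r (a : nat -> A) k : smul a (fun=> 0) k = 0.
Proof. by rewrite /smul big1 // => l _; rewrite mulr0. Qed.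

Lemma smul0l (a : nat -> A) k : smul (fun=> 0) a k = 0.
Proof. by rewrite /smul big1 // => l _; rewrite mul0r. Qed.

Lemma smul1r (a : nat -> A) k : smul a one_ser k = a k.
Proof.
rewrite /smul big_ord_recr /= subnn mulr1 big1 ?add0r // => l _.
by rewrite subn_eq0 leqNgt ltn_ord mulr0.
Qed.

Lemma smul1l (a : nat -> A) k : smul one_ser a k = a k.
Proof.
rewrite /smul big_ord_recl /= subn0 mul1r big1 ?addr0 // => l _.
by rewrite mul0r.
Qed.

Lemma iter_der0 l : iter l der (fun=> 0) = fun=> 0.
Proof. by elim: l => //= l ->. Qed.

Lemma order_dmul X Y p q : order_le X p -> order_le Y q ->
  order_le (dmul der bnd X Y) (p + q).
Proof.
move=> Xp Yq r lt_r; apply: functional_extensionality => k.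
rewrite /dmul big1 // => p' _; rewrite big1 // => q' _; rewrite big1 // => l _.
case: eqP => // Er; have [/Xp->|le_p] := ltnP p p'; first by rewrite smul0l mulr0.
have [/Yq->|le_q] := ltnP q q'; last by have := ltn_ord l; lia.
by rewrite iter_der0 smul0r mulr0.
Qed.

Lemma linfactor_order c e : order_le (linfactor c e) c.
Proof.
move=> r lt_r; apply: functional_extensionality => k; rewrite /linfactor.
case: c lt_r => /=; case: r => [|[|r]] //= _; rewrite ?subr0 //.
Qed.

Lemma linfactor1 e : linfactor true e 1 = one_ser.
Proof.
by apply: functional_extensionality => k; rewrite /linfactor /= subr0; case: eqP.
Qed.

Lemma linfactor0 c e : linfactor c e 0 = fun k => - e k.
Proof.
by apply: functional_extensionality => k; rewrite /linfactor /= andbF sub0r.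
Qed.

(** Leibniz rule for (d - e) Y: moving d past the coefficient of d^r gives one term of order r + 1
    and one derivative of order r. *)
Lemma dmul_linfactor e (Y : dop A) r k : (1 < bnd)%N -> (r < bnd)%N ->
  dmul der bnd (linfactor true e) Y r k =
  smul (fun k => - e k) (Y r) k + (if r is r'.+1 then Y r' k else 0) + der (Y r) k.
Proof.
move=> lt1 lt_r; rewrite /dmul.
have -> : \sum_(p < bnd) \sum_(q < bnd) \sum_(l < p.+1)
     (if (p + q - l == r)%N then 'C(p, l)%:R * smul (linfactor true e p) (iter l der (Y q)) k
      else 0) =
  \sum_(p < 2) \sum_(q < bnd) \sum_(l < p.+1)
     (if (p + q - l == r)%N then 'C(p, l)%:R * smul (linfactor true e p) (iter l der (Y q)) k
      else 0).
  rewrite [RHS](big_ord_widen bnd (fun p => \sum_(q < bnd) \sum_(l < p.+1)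
     (if (p + q - l == r)%N then 'C(p, l)%:R * smul (linfactor true e p) (iter l der (Y q)) k
      else 0))) // [RHS]big_mkcond; apply: eq_bigr => p _.
  case: ltnP => // le2; apply: big1 => q _; apply: big1 => l _.
  by rewrite (linfactor_order (c := true)) // smul0l mulr0 if_same.
rewrite big_ord_recl big_ord1 /= -addrA; congr (_ + _).
  rewrite (bigD1 (Ordinal lt_r)) //= big_ord1 add0n subn0 eqxx bin0 mul1r linfactor0.
  rewrite big1 ?addr0 // => q; rewrite -val_eqE /= big_ord1 add0n subn0 => /negPf->//.
rewrite (eq_bigr (fun q : 'I_bnd => (if q.+1 == r then Y q k else 0) +
    (if q == r :> nat then der (Y q) k else 0))); last first.
  move=> q _; rewrite big_ord_recl big_ord1 /= /bump /= linfactor1 !smul1l.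
  by rewrite !addn0 bin0 binn !mul1r subn0 add1n subn1.
rewrite big_split /=; congr (_ + _); last first.
  rewrite (bigD1 (Ordinal lt_r)) //= eqxx big1 ?addr0 // => q.
  by rewrite -val_eqE /= => /negPf->.
case: r lt_r => [|r] lt_r; first by rewrite big1.
rewrite (bigD1 (Ordinal (ltnW lt_r))) //= eqxx big1 ?addr0 // => q.
by rewrite -val_eqE /= eqSS => /negPf->.
Qed.

Lemma order_prod (I : Type) (s : seq I) (c : I -> bool) (e : I -> nat -> A) :
  order_le (\big[dmul der bnd/@dunit A]_(i <- s) linfactor (c i) (e i)) (count c s).
Proof.
elim: s => [|i s IH] /=.
  rewrite big_nil => r lt_r; apply: functional_extensionality => k.
  by rewrite /dunit (gtn_eqF lt_r).
by rewrite big_cons; apply: order_dmul => //; exact: linfactor_order.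
Qed.

(** The leading coefficient stays 1 and has zero derivative, so derivatives of the e_i enter only
    below the two top orders. *)
Lemma prod_linfactor (I : Type) (s : seq I) (e : I -> nat -> A) : (size s < bnd)%N ->
  let Z := \big[dmul der bnd/@dunit A]_(i <- s) linfactor true (e i) in
  Z (size s) = one_ser /\
  forall r, r.+1 = size s -> forall k, Z r k = - \sum_(i <- s) e i k.
Proof.
elim: s => [_|i s IH lt_s] /=.
  by rewrite big_nil.
have [Ztop Zsub] := IH (ltnW lt_s); rewrite big_cons.
have Zord := @order_prod I s (fun=> true) e.
set Z := \big[_/_]_(_ <- _) _ in Ztop Zsub Zord *.
have lt1 : (1 < bnd)%N by apply: leq_trans lt_s.
have Zs : Z (size s).+1 = fun=> 0 by apply: Zord; rewrite count_predT.
split=> [|r [Er] k].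
  apply: functional_extensionality => k.
  by rewrite dmul_linfactor // Zs smul0r der0 add0r addr0 Ztop.
rewrite Er dmul_linfactor ?(ltnW lt_s) // Ztop smul1r der1 addr0 big_cons opprD.
congr (_ + _); case: s Er {IH lt_s} @Z Ztop Zsub Zord Zs => [|i' s] Er Z Ztop Zsub Zord Zs.
  by rewrite big_nil oppr0.
exact: Zsub.
Qed.

End RowDet.

(** * Bethe operators as matrices, and the grading of M_lambda *)

Section Bethe.
Variables (C : numFieldType) (N n : nat).
Implicit Types (x y : Vec C N n) (lam : 'I_N -> nat).

Lemma sum_Eop s : \sum_i Eop C s i i = 1%:M :> Mat C N n.
Proof.
apply/matrixP => a b; rewrite summxE mxE (bigD1 ((enum_val b : Tn N n) s)) //=.
rewrite mxE eqxx andbT big1 ?addr0 => [|i /negPf ib]; last first.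
  by rewrite mxE [_ == i]eq_sym ib andbF.
congr (_%:R); congr (nat_of_bool _); apply/eqP/eqP => [Eab|->].
  apply: enum_val_inj; rewrite Eab; apply/ffunP => t; rewrite ffunE.
  by case: eqP => [->|].
by apply/ffunP => t; rewrite ffunE; case: eqP => [->|].
Qed.

Lemma derW0 : derW (fun=> 0) = (fun=> 0) :> (nat -> Mat C N n).
Proof.
by apply: functional_extensionality => -[|k] //=; rewrite mul0rn oppr0.
Qed.

Lemma derW1 : derW (fun k => (k == 0%N)%:R) = (fun=> 0) :> (nat -> Mat C N n).
Proof.
by apply: functional_extensionality => -[|[|k]] //=; rewrite ?mulr0n ?mul0rn oppr0.
Qed.

(** If s moves i, it also moves s i. Hence a term of the row determinant for s different from 1 has
    order at most N - 2. *)
Lemma card_fixed (s : 'S_N) : s != 1%g -> ((count (fun i => i == s i) (index_enum 'I_N)).+1 < N)%N.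
Proof.
move=> s1; have [i si] : exists i, s i != i.
  apply/existsP; apply: contraR s1 => /existsPn s1.
  by apply/eqP/permP => i; rewrite perm1; apply/eqP; have := s1 i; rewrite negbK.
pose A : pred 'I_N := fun j => j == s j.
have -> : count (fun j => j == s j) (index_enum 'I_N) = #|A| by rewrite -sum1_count sum1_card.
have : (2 <= #|[predC A]|)%N.
  have -> : 2%N = #|[set i; s i]| by rewrite cards2 eq_sym si.
  apply: subset_leq_card; apply/subsetP => j; rewrite !inE /A /=.
  by case/orP => /eqP->; rewrite unfold_in ?(inj_eq perm_inj) eq_sym.
by have := cardC A; rewrite card_ord => cA c2;
  apply: leq_trans (eq_leq cA); rewrite -addn2 leq_add2l.
Qed.

(* Only the identity permutation contributes to the coefficient of [d^(N-1)],
   which is minus the trace of the matrix [e_ij(u)]. *)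
Lemma Bhat1 j : (0 < N)%N -> Bhat C N n 1 j.+1 = (- \sum_(s < n) 'X_s ^+ j)%:M.
Proof.
move=> N0; have EN : (N - 1).+1 = N by lia.
rewrite /Bhat /BetheOp /rdet (bigD1 1%g) //= big1 ?addr0.
  rewrite odd_perm1 expr0 mul1r.
  rewrite (eq_bigr (fun i => linfactor true (eser C n i i))) => [|i _]; last first.
    rewrite perm1 (_ : BetheEntry C n i i = linfactor (i == i) (eser C n i i)) //.
    by rewrite eqxx.
  have sz : size (index_enum 'I_N) = N by rewrite -[RHS]card_ord cardE enumT.
  have [_] := @prod_linfactor _ _ N.+1 derW0 derW1 _ (index_enum 'I_N)
    (fun i => eser C n i i) (leq_ltn_trans (eq_leq sz) (ltnSn N)).
  move=> -> //; last by rewrite sz.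
  rewrite exchange_big /= -scalemx1 scaleNr scaler_suml; congr (- _).
  by apply: eq_bigr => s _; rewrite -scaler_sumr sum_Eop.
move=> s s1.
have ord := @order_prod _ _ N.+1 derW0 'I_N (index_enum 'I_N) (fun i => i == s i)
  (fun i => eser C n (s i) i).
have -> : \big[dmul (@derW C N n) N.+1/@dunit (Mat C N n)]_(i < N) BetheEntry C n i (s i) =
    \big[dmul (@derW C N n) N.+1/@dunit (Mat C N n)]_(i < N)
      linfactor (i == s i) (eser C n (s i) i) by [].
by rewrite ord ?mulr0 // ltn_subRL add1n; exact: card_fixed.
Qed.

Lemma bethe_gen_mx T : @bethe_gen C N n T -> exists A, forall x, T x = A *m x.
Proof.
elim=> [i j _ _||U W _ [A EA] _ [B EB]|U W _ [A EA] _ [B EB]|c U _ [A EA]].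
- by exists (Bhat C N n i j).
- by exists 1%:M => x; rewrite mul1mx.
- by exists (A + B) => x; rewrite EA EB mulmxDl.
- by exists (A *m B) => x; rewrite EB EA mulmxA.
- by exists (c%:MP *: A) => x; rewrite EA scalemxAl.
Qed.

(** Take for r the product of all S_n-conjugates of the characteristic polynomial, a norm down to
    the symmetric polynomials. *)
Lemma sym_char_poly m (A : 'M[Poly C n]_m) : exists p r : {poly Poly C n},
  [/\ r = p * char_poly A, r \is monic & forall k, r`_k \is symmetric].
Proof.
pose F (s : 'S_n) := map_poly (msym s) (char_poly A).
exists (\prod_(s | s != 1%g) F s), (\prod_s F s); split.
- rewrite (bigD1 1%g) //= mulrC; congr (_ * _).
  by apply/polyP => i; rewrite coef_map /= msym1m.
- by apply: monic_prod => s _; apply: monic_map; exact: char_poly_monic.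
move=> k; apply/issymP => t; rewrite -[LHS]coef_map /=.
suff -> : map_poly (msym t) (\prod_s F s) = \prod_s F s by [].
rewrite rmorph_prod [RHS](reindex_inj (mulIg t)) /=; apply: eq_bigr => s _.
by apply/polyP => i; rewrite !coef_map /= msymMm.
Qed.

Lemma vec_coordP x y : (forall b, coord x b = coord y b) -> x = y.
Proof.
move=> xy; apply/matrixP => a l; rewrite (ord1 l) -(enum_valK a).
exact: xy.
Qed.

Lemma homogVP k x : homogV k x <-> forall b m, (coord x b)@_m != 0 -> mdeg m = k.
Proof. by split=> xk b m; have := xk b m; rewrite mcoeff_msupp. Qed.

Lemma homogV_lin k (a : C) x y :
  homogV k x -> homogV k y -> homogV k (a%:MP *: x + y).
Proof.
move=> /homogVP xk /homogVP yk; apply/homogVP => b m.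
rewrite coordD coordZ mcoeffD mcoeffCM; have [x0|/xk//] := eqVneq ((coord x b)@_m) 0.
by rewrite x0 mulr0 add0r => /yk.
Qed.

Lemma homogV0 k : homogV k (0 : Vec C N n).
Proof. by apply/homogVP => b m; rewrite /coord mxE mcoeff0 eqxx. Qed.

Lemma inM_lin lam (a : C) x y : inM lam x -> inM lam y -> inM lam (a%:MP *: x + y).
Proof.
move=> [xS xw xE] [yS yw yE]; split.
- move=> s b; rewrite !coordD !coordZ !mul_mpolyC msymD msymZ.
  by rewrite -xS -yS.
- by move=> i; rewrite mulmxDr -scalemxAr xw yw scalerDr !scalerA mulrC.
- by move=> i j lt_ij; rewrite mulmxDr -scalemxAr xE // yE // scaler0 addr0.
Qed.

Definition hcomp k x : Vec C N n := \col_a pihomog mdeg k (x a 0).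

Lemma coord_hcomp k x b : coord (hcomp k x) b = pihomog mdeg k (coord x b).
Proof. by rewrite /coord mxE. Qed.

Lemma homogV_hcomp k x : homogV k (hcomp k x).
Proof. by move=> b; rewrite coord_hcomp; apply/dhomogP; exact: pihomogP. Qed.

Lemma inM_hcomp lam k x : inM lam x -> inM lam (hcomp k x).
Proof.
move=> [xS xw xE]; split.
- by move=> s b; rewrite !coord_hcomp msym_pihomog -xS.
- move=> i; apply: vec_coordP => b; have := congr1 (fun y => coord y b) (xw i).
  rewrite /= !glactE !coordZ coord_hcomp mulr_natl => E.
  rewrite mulr_natl -raddfMn -E raddf_sum; apply: eq_bigr => s _.
  by rewrite coord_hcomp.
- move=> i j lt_ij; apply: vec_coordP => b; have := congr1 (fun y => coord y b) (xE i j lt_ij).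
  rewrite /= !glactE => E.
  transitivity (pihomog mdeg k (coord (0 : Vec C N n) b)); last by rewrite /coord !mxE raddf0.
  by rewrite -E raddf_sum; apply: eq_bigr => s _; rewrite coord_hcomp.
Qed.

Lemma sum_hcomp x : exists B, x = \sum_(k < B) hcomp k x.
Proof.
exists (\max_a msize (x a 0%R))%N; apply/matrixP => a l; rewrite (ord1 l) summxE.
under [RHS]eq_bigr do rewrite mxE.
by apply: pihomog_partitionE; exact: (leq_bigmax a).
Qed.

End Bethe.

(** * Injectivity and surjectivity of mu *)

Section RegularRep.
Variables (C : numFieldType) (N n : nat) (lam : 'I_N -> nat).
Local Notation O := (Oring C lam).
Local Notation V := (Vec C N n).
Implicit Types (x y : V) (G H : O).

Hypothesis lamP : is_part lam.
Hypothesis Hn : n = (\sum_(i < N) lam i)%N.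
Variables (F : nat -> nat -> O) (tau : O -> V -> V).
Hypothesis tau_stable : forall G x, inM lam x -> inM lam (tau G x).
Hypothesis tau_add : forall G H x, inM lam x -> tau (G + H) x = tau G x + tau H x.
Hypothesis tau_scale : forall (c : C) G x, inM lam x -> tau (c *: G) x = c%:MP *: tau G x.
Hypothesis tau_mul : forall G H x, inM lam x -> tau (G * H) x = tau G (tau H x).
Hypothesis tau_one : forall x, inM lam x -> tau 1 x = x.
Hypothesis tau_F : forall i j : nat, (1 <= i <= N)%N -> (1 <= j)%N ->
  forall x, inM lam x -> tau (F i j) x = Bhat C N n i j *m x.
Hypothesis tau_graded : forall G k x l, whomog k G -> inM lam x -> homogV l x ->
  homogV (k + l) (tau G x).
Hypothesis tau_inj : forall G, (forall x, inM lam x -> tau G x = 0) -> G = 0.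
Hypothesis tau_onto : forall G, exists T, @bethe_gen C N n T /\
  forall x, inM lam x -> tau G x = T x.
Variable v : V.
Hypothesis Hv : inM lam v.
Hypothesis Hv0 : v != 0.
Hypothesis Hvdeg : homogV (content lam) v.

Lemma tau0 x : inM lam x -> tau 0 x = 0.
Proof. by move=> xM; rewrite -(scale0r 1) tau_scale // mpolyC0 scale0r. Qed.

Lemma tau_lin (c : C) G H x : inM lam x ->
  tau (c *: G + H) x = c%:MP *: tau G x + tau H x.
Proof. by move=> xM; rewrite tau_add ?tau_scale. Qed.

Lemma tau_sum (I : Type) (s : seq I) (G : I -> O) x : inM lam x ->
  tau (\sum_(i <- s) G i) x = \sum_(i <- s) tau (G i) x.
Proof.
move=> xM; elim: s => [|i s IH]; first by rewrite !big_nil tau0.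
by rewrite !big_cons tau_add // IH.
Qed.

Definition multiplier (p : Poly C n) := exists G, forall x, inM lam x -> tau G x = p *: x.

Lemma multiplier_sym p : p \is symmetric -> multiplier p.
Proof.
apply: symmetric_powersum => [c|p1 p2|p1 p2|k].
- by exists (c *: 1) => x xM; rewrite tau_scale // tau_one.
- by move=> [G1 E1] [G2 E2]; exists (G1 + G2) => x xM; rewrite tau_add // E1 // E2 // scalerDl.
- move=> [G1 E1] [G2 E2]; exists (G1 * G2) => x xM.
  by rewrite tau_mul // E1 ?E2 ?scalerA // -E2 //; exact: tau_stable.
(* For N = 0 there is no B_1, but then n = 0 and the power sums are empty. *)
have [N0|N0] := posnP N.
  exists 0 => x xM; rewrite tau0 // big1 ?scale0r // => s _.
  have := ltn_ord s; rewrite [X in (_ < X)%N]Hn big1 // => i _.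
  by have := ltn_ord i; rewrite [X in (_ < X)%N]N0.
(* By [Bhat1], B_(1,k+1) acts as minus the k-th power sum. *)
exists ((-1) *: F 1 k.+1) => x xM.
rewrite tau_scale // tau_F // Bhat1 // mul_scalar_mx scalerA.
by rewrite mpolyCN mulN1r opprK.
Qed.

Lemma multiplier_poly (r : {poly Poly C n}) : (forall k, r`_k \is symmetric) ->
  exists p : {poly O}, forall k x, inM lam x -> tau p`_k x = r`_k *: x.
Proof.
elim/poly_ind: r => [_|r c IH rS].
  by exists 0 => k x xM; rewrite !coef0 tau0 // scale0r.
have [p pE] : exists p : {poly O}, forall k x, inM lam x -> tau p`_k x = r`_k *: x.
  apply: IH => k; have := rS k.+1.
  by rewrite coefD coefMX coefC /= addr0.
have [g gE] : multiplier c.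
  by apply: multiplier_sym; have := rS 0%N; rewrite coefD coefMX coefC /= add0r.
exists (p * 'X + g%:P) => -[|k] x xM; rewrite !coefD !coefMX !coefC /=.
  by rewrite !add0r gE.
by rewrite !addr0 pE.
Qed.

Lemma scale_v_eq0 (p : Poly C n) : p *: v = 0 -> p = 0.
Proof.
move=> pv; apply/eqP; apply: contraNT Hv0 => p0; apply/eqP/matrixP => a l.
have /eqP := congr1 (fun y : V => y a l) pv.
by rewrite !mxE mulf_eq0 (negPf p0) => /eqP.
Qed.

(* By Cayley-Hamilton each [tau G] is integral over the symmetric polynomials,
   so a nonzero [G] divides a nonzero element acting as a symmetric polynomial,
   and [v] has no torsion. *)
Lemma tau_v_eq0 G : tau G v = 0 -> G = 0.
Proof.
move=> Gv; apply/eqP; apply: contraT => G0.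
have [T [/bethe_gen_mx[A TE] GT]] := tau_onto G.
have GA x : inM lam x -> tau G x = A *m x by move=> xM; rewrite GT.
have [p [r [rE r_monic rS]]] := sym_char_poly A.
have [g gE] := multiplier_poly rS.
have tauX k x : inM lam x -> tau (G ^+ k) x = iter k (mulmx A) x.
  move=> xM; elim: k => [|k IH]; first by rewrite expr0 tau_one.
  by rewrite exprS tau_mul // iterS -IH GA //; exact: tau_stable.
(* The coefficient of g at the degree of the monic r acts as 1 on [v]. *)
have g0 : g != 0.
  apply/eqP => g0; have := gE (size r).-1 v Hv.
  rewrite g0 coef0 tau0 // -/(lead_coef r) (monicP r_monic) scale1r => /esym/eqP.
  by rewrite (negPf Hv0).
have gG : root g G.
  apply/eqP/tau_inj => x xM; rewrite (horner_coef_wide G (leq_maxl (size g) (size r))).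
  rewrite tau_sum // -[RHS](mul_char_poly_kills x rE (leq_maxr (size g) (size r))).
  by apply: eq_bigr => i _; rewrite tau_mul // gE ?tauX //; rewrite -tauX //; exact: tau_stable.
have [m [h [gm0 gmE]]] := root_low_coef g0 gG G0.
(* The hypotheses give linearity of [tau] in its first argument, so the zero vector is written as
   [tau 0 v]. *)
have h0 : tau h 0 = 0 by rewrite -(tau0 Hv) -tau_mul // mulr0.
have rm0 : r`_m = 0 by apply: scale_v_eq0; rewrite -gE // gmE tau_mul // Gv h0.
by case/eqP: gm0; apply: tau_inj => x xM; rewrite gE // rm0 scale0r.
Qed.

Definition monom k (f : {ffun 'I_(nvar lam) -> 'I_k.+1}) : 'X_{1..nvar lam} :=
  [multinom (f i : nat) | i < nvar lam].

Lemma monom_inj k : injective (@monom k).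
Proof.
move=> f g /mnmP fg; apply/ffunP => i; apply: val_inj.
by have := fg i; rewrite !mnmE.
Qed.

Lemma whomog_monom k (f : {ffun 'I_(nvar lam) -> 'I_k.+1}) :
  whomog (\sum_i f i * hook i)%N ('X_[monom f] : O).
Proof.
move=> m; rewrite msuppX inE => /eqP->.
by apply: eq_bigr => i _; rewrite mnmE.
Qed.

(** Apply the monomials of degree k - n(lambda) to [v] and read off coefficients at tableaux. This
    map is injective by [tau_v_eq0] and [singular_determined], hence onto, as [size_ssyt] allows no
    more tableaux than monomials. Some G thus matches x at all tableaux, and the difference is 0. *)
Lemma homog_surj k x : inM lam x -> homogV k x -> exists G, tau G v = x.
Proof.
move=> xM xk.
pose S := ssyt k.+1 [ffun i => lam i] k.
pose B := [set f : {ffun 'I_(nvar lam) -> 'I_k.+1} | (\sum_i f i * hook i + content lam == k)%N].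
pose X (i : 'I_#|B|) : O := 'X_[monom (enum_val i)].
pose G (u : 'rV[C]_#|B|) : O := \sum_i u 0 i *: X i.
pose ev y (j : 'I_(size S)) := wordcoef y (letters 0 (nth [::] S j)).
pose E : 'M[C]_(#|B|, size S) := \matrix_(i, j) ev (tau (X i) v) j.
have tauG u : tau (G u) v = \sum_i (u 0 i)%:MP *: tau (X i) v.
  by rewrite /G tau_sum //; apply: eq_bigr => i _; rewrite tau_scale.
have evE u j : (u *m E) 0 j = ev (tau (G u) v) j.
  rewrite tauG /ev wordcoef_sum mxE; apply: eq_bigr => i _.
  by rewrite [E _ _]mxE.
have XM i : homogV k (tau (X i) v).
  have := enum_valP i; rewrite inE => /eqP Ek; rewrite -[Y in homogV Y _]Ek.
  by apply: tau_graded => //; exact: whomog_monom.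
have Gk u : homogV k (tau (G u) v).
  rewrite tauG; elim: (index_enum _) => [|i s IH]; first by rewrite big_nil; exact: homogV0.
  by rewrite big_cons; exact: homogV_lin.
have determined y : inM lam y -> homogV k y -> (forall j, ev y j = 0) -> y = 0.
  move=> yM yk y0; apply: (singular_determined yM yk) => w wS.
  have jS : (index w S < size S)%N by rewrite index_mem.
  by have := y0 (Ordinal jS); rewrite /ev /= nth_index.
have injE (u : 'rV_#|B|) : u *m E = 0 -> u = 0.
  move=> uE; have Gu0 : G u = 0.
    apply: tau_v_eq0; apply: determined => //; first exact: tau_stable.
    by move=> j; rewrite -evE uE mxE.
  apply/rowP => i; rewrite mxE.
  have := congr1 (mcoeff (monom (enum_val i))) Gu0.
  rewrite mcoeff0 /G raddf_sum /= (bigD1 i) //= mcoeffZ mcoeffX eqxx mulr1 big1 ?addr0 //.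
  move=> j ji; rewrite mcoeffZ mcoeffX (inj_eq (@monom_inj k)) (inj_eq enum_val_inj).
  by rewrite (negPf ji) mulr0.
have [u uE] := row_inj_surj (size_ssyt k.+1 k lamP) injE (\row_j ev x j).
exists (G u); apply/eqP; rewrite -subr_eq0 -opprB oppr_eq0; apply/eqP.
have -> : x - tau (G u) v = (-1)%:MP *: tau (G u) v + x.
  by rewrite mpolyCN mpolyC1 scaleN1r addrC.
apply: determined.
- by apply: inM_lin => //; exact: tau_stable.
- exact: homogV_lin.
by move=> j; rewrite /ev wordcoef_lin -/(ev _ _) -evE uE mxE mulN1r addNr.
Qed.

Lemma tau_v_surj x : inM lam x -> exists G, tau G v = x.
Proof.
move=> xM; have [B ->] := sum_hcomp x; elim: B => [|B [G IH]].
  by exists 0; rewrite big_ord0 tau0.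
have [H HE] := homog_surj (inM_hcomp B xM) (@homogV_hcomp _ _ _ B x).
by exists (G + H); rewrite big_ord_recr tau_add // IH HE.
Qed.

End RegularRep.

Theorem theorem5p6 (R : rcfType) (N n : nat) (lam : 'I_N -> nat)
  (Hpart : forall i j : 'I_N, (i <= j)%N -> (lam j <= lam i)%N)
  (Hn : n = (\sum_(i < N) lam i)%N)
  (F : nat -> nat -> Oring R[i] lam) (HF : is_F F)
  (tau : Oring R[i] lam -> Vec R[i] N n -> Vec R[i] N n)
  (* tau : O_lambda -> B_lambda \subset End(M_lambda) is an algebra morphism *)
  (tau_stable : forall G x, inM lam x -> inM lam (tau G x))
  (tau_add : forall G H x, inM lam x -> tau (G + H) x = tau G x + tau H x)
  (tau_scale : forall (c : R[i]) G x, inM lam x -> tau (c *: G) x = c%:MP *: tau G x)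
  (tau_mul : forall G H x, inM lam x -> tau (G * H) x = tau G (tau H x))
  (tau_one : forall x, inM lam x -> tau 1 x = x)
  (* tau(F_ij) = \hat B_ij *)
  (tau_F : forall i j : nat, (1 <= i <= N)%N -> (1 <= j)%N ->
             forall x, inM lam x -> tau (F i j) x = Bhat R[i] N n i j *m x)
  (* graded *)
  (tau_graded : forall G k x l, whomog k G -> inM lam x -> homogV l x ->
             homogV (k + l) (tau G x))
  (* isomorphism onto B_lambda *)
  (tau_inj : forall G, (forall x, inM lam x -> tau G x = 0) -> G = 0)
  (tau_onto : forall G, exists T, @bethe_gen R[i] N n T /\
             forall x, inM lam x -> tau G x = T x)
  (* the lowest-degree vector *)
  (v : Vec R[i] N n) (Hv : inM lam v) (Hv0 : v != 0)
  (Hvdeg : homogV (\sum_(i < N) i * lam i)%N v) :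
  let mu := fun G => tau G v in
  let delta := (\sum_(i < N) i * lam i)%N in
  [/\ (forall G, inM lam (mu G)),
      (forall (c : R[i]) G H, mu (c *: G + H) = c%:MP *: mu G + mu H),
      (forall G H, mu G = mu H -> G = H),
      (forall x, inM lam x -> exists G, mu G = x)
    & (forall G k, whomog k G -> homogV (k + delta) (mu G))]
  /\ (forall G H, mu (G * H) = tau G (mu H)).
Proof.
move=> mu delta; split; last by move=> G H; exact: tau_mul.
split=> [G|c G H|G H|x|G k].
- exact: tau_stable.
- exact: tau_lin.
- move=> E; apply/eqP; rewrite -subr_eq0; apply/eqP.
  apply: (tau_v_eq0 Hn tau_stable tau_add tau_scale tau_mul tau_one tau_F tau_inj tau_onto Hv Hv0).
  by rewrite addrC -scaleN1r (tau_lin tau_add tau_scale) // mpolyCN scaleN1r -/(mu G) E addNr.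
- exact: (tau_v_surj Hpart Hn tau_stable tau_add tau_scale tau_mul tau_one tau_F tau_graded
            tau_inj tau_onto Hv Hv0 Hvdeg).
- by move=> Gk; exact: tau_graded.
Qed.
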